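(* Consider a feedforward network and assume bifurcation assumption (B) with non-maximal critical cells (so $K=\sum_{\sigma\in\Sigma}a_\sigma\ne0$). Let $B\subset C$ be a root subnetwork for which real non-zero coefficients $(D_p)_{p\in C}$ can be defined recursively along $\trianglelefteq$ by (with $A_p:=\sum_{\sigma,\tau\in\mathcal L_p}f_{\sigma\tau}$): - $p\in B$: $D_p=\ell/K$; - $p\notin B$ non-critical, $\mu_p=0$: $D_p=-\bigl(\sum_{\tau\notin\mathcal L_p}a_\tau D_{\tau(p)}-\ell\bigr)/\sum_{\sigma\in\mathcal L_p}a_\sigma$; - $p\notin B$ non-critical, $\mu_p>0$: $D_p=-\bigl(\sum_{\tau:\tau(p)\in\mathbf Q_p}a_\tau D_{\tau(p)}\bigr)/\sum_{\sigma\in\mathcal L_p}a_\sigma$; - $p\notin B$ critical, $\mu_p=0$: $D_p=-\frac{\ell}{K}\bigl(1+2\frac{\sum_{\sigma\in\mathcal L_p,\tau\notin\mathcal L_p}f_{\sigma\tau}}{A_p}\bigr)+\frac{\sum_{\sigma\in\mathcal L_p}f_{\sigma\lambda}}{A_p}$; - $p$ critical, $\mu_p=1$: $D_p=\pm\sqrt{-\bigl(\sum_{\tau\notin\mathcal L_p}a_\tau D_{\tau(p)}-\ell\bigr)/A_p}$; - $p$ critical, $\mu_p>1$: $D_p=\pm\sqrt{-\bigl(\sum_{\tau:\tau(p)\in\mathbf Q_p}a_\tau D_{\tau(p)}\bigr)/A_p}$, such that (for the chosen signs) $$\frac{\sum_{\tau\notin\mathcal L_p}a_\tau D_{\tau(p)}-\ell}{A_p}<0\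 \text{for critical $p$ with }\mu_p=1,\qquad\frac{\sum_{\tau:\tau(p)\in\mathbf Q_p}a_\tau D_{\tau(p)}}{A_p}<0\ \text{for critical $p$ with }\mu_p>1.$$ Then there is a branch of steady states of $\gamma_f(x,\lambda)=0$ with $$x_p(\lambda)=X(\lambda)=D_p\cdot(-\lambda)+O(|\lambda|^2)\ \ (p\in B),\qquad x_p(\lambda)=D_p(-\lambda)^{2^{-\mu_p}}+O\bigl(|\lambda|^{2^{-(\mu_p-1)}}\bigr)\ \ (p\notin B)$$ for small $\lambda<0$. In particular the cells in $B$ are synchronous, following $X(\lambda)$, and the cells not in $B$ are not synchronous with those in $B$.
   Context: Network: finite cells $C$, pairwise distinct maps $\Sigma=\{\sigma_1,\dots,\sigma_n\}$, $\sigma_i\colon C\to C$, $\sigma_1=\mathrm{Id}_C$; arrow of type $\sigma$ from $q$ to $p$ iff $\sigma(p)=q$. A path from $p$ to $q$ is a set $\{p_1,\dots,p_k\}$ of pairwise distinct cells with $p_1=p$, $p_k=q$, $\tau_j(p_{j+1})=p_j$ for some $\tau_j\in\Sigma$; $\Omega_{p,q}$ is the set of such paths. Feedforward: no cycles of length $\ge2$ (a cycle is a path $\{p_1,\dots,p_k\}$ with additionally $\tau(p_1)=p_k$ for some $\tau$). $p\trianglelefteq q$ iff there is a path from $q$ to $p$ (partial order); $q\vartriangleright p$ iff $p\trianglelefteq q$, $p\ne q$; maximal cells have $\sigma(p)=p$ for all $\sigma$. $\Sigma^\star(p)=\{\sigma(p):\sigma\in\Sigma\}\setminus\{p\}$.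 Subnetwork: nonempty $B$ with $\sigma(B)\subset B$ for all $\sigma$. Root subnetwork: subnetwork $B\subsetneq C$ containing all maximal cells such that each $p\notin B$ with all $q\vartriangleright p$ in $B$ is critical. Bifurcation setting: $V=\mathbb R$, smooth $f\colon\mathbb R^n\times\mathbb R\to\mathbb R$ with first $n$ arguments labelled by $\Sigma$, $\gamma_f(x,\lambda)_p=f(x_{\sigma_1(p)},\dots,x_{\sigma_n(p)},\lambda)$. Coefficients: $a_\sigma=\partial_\sigma f(0,0)$, $f_{\sigma\tau}=\tfrac12\partial_\sigma\partial_\tau f(0,0)$, $f_{\sigma\lambda}=\partial_\sigma\partial_\lambda f(0,0)$, $\ell=\partial_\lambda f(0,0)$, $f_{\lambda\lambda}=\tfrac12\partial_\lambda^2f(0,0)$. $\mathcal L_p=\{\sigma:\sigma(p)=p\}$; $p$ critical iff $\sum_{\sigma\in\mathcal L_p}a_\sigma=0$. (B): $f(0,0)=0$, some cell critical, exactly the cells sharing $\mathcal L_p$ with a critical cell are critical. $X(\lambda)=-\frac{\ell}{K}\lambda+O(\lambda^2)$ is the unique steady-state branch in the fully synchronous subspace. For $p\notin B$: $\mu_p=\max_{\bar p\in B}\max_{\omega\in\Omega_{\bar p,p}}\#\{q\in\omega: q\text{ critical},q\notin B\}-1$; $\mu_p=0$ for $p\in B$. $\mathbf Q_p=\{q\in\Sigma^\star(p):\mu_q=\max_{s\vartriangleright p}\mu_s\}$.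
   Formalization: The closing claim that cells outside B are not synchronous with those in B is left out: it can fail when μ_p=0 and D_p=ℓ/K (e.g. f=x₂+ℓλ+(x₁−x₂)² on two cells); when μ_p>0 or D_p≠ℓ/K it follows at once from the expansions. *)

(* Defs.v *)
From HB Require Import structures.
From mathcomp Require Import all_boot all_order all_algebra.
From mathcomp Require Import all_classical all_reals all_analysis.
Set Implicit Arguments.
Unset Strict Implicit.
Unset Printing Implicit Defensive.
Import Order.TTheory GRing.Theory Num.Theory.
Import numFieldNormedType.Exports.
Local Open Scope ring_scope.

Section Network.
Variables (C : finType) (n : nat) (sigma : 'I_n.+1 -> C -> C).

Definition arrow (x y : C) : bool := [exists i, sigma i y == x].

Definition is_path (p q : C) (s : seq C) : bool :=
  if s is x :: s' then [&& x == p, last x s' == q, path arrow x s' & uniq s]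
  else false.

Definition feedforward : Prop :=
  forall p q (s : seq C), is_path p q s -> (2 <= size s)%N -> ~~ arrow q p.

(* p <| q  iff there is a path from q to p (paths have at most #|C| cells) *)
Definition trle (p q : C) : bool :=
  [exists k : 'I_#|C|.+1, [exists t : (k : nat).-tuple C, is_path q p t]].

Definition trgt (q p : C) : bool := trle p q && (p != q).

Definition maximal (p : C) : bool := [forall i, sigma i p == p].

Definition Lset (p : C) : {set 'I_n.+1} := [set i | sigma i p == p].

Variable R : realType.
Variable a : 'I_n.+1 -> R.

Definition critical (p : C) : bool := \sum_(i | sigma i p == p) a i == 0.

Definition subnetwork (B : {set C}) : Prop :=
  (exists p, p \in B) /\ forall i p, p \in B -> sigma i p \in B.

Definition root_subnetwork (B : {set C}) : Prop :=
  [/\ subnetwork B, (exists p, p \notin B) (* B <> C *),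
      forall p, maximal p -> p \in B &
      forall p, p \notin B -> (forall q, trgt q p -> q \in B) -> critical p].

Definition mu (B : {set C}) (p : C) : nat :=
  if p \in B then 0%N else
  ((\max_(k < #|C|.+1)
     \max_(t : (k : nat).-tuple C | [exists pb in B, is_path pb p t])
        count (fun q => critical q && (q \notin B)) t) - 1)%N.

Definition inQ (B : {set C}) (p q : C) : bool :=
  [&& [exists i, sigma i p == q], q != p &
      mu B q == \max_(s | trgt s p) mu B s].
End Network.

Section Field.
Variables (R : realType) (n : nat).

(* the variables (x_{sigma_1},...,x_{sigma_n}; lambda) *)
Definition V := ('rV[R]_n.+1 * R)%type.

Definition ex (i : 'I_n.+1) : V := (delta_mx 0 i, 0).
Definition elam : V := (0, 1).

Fixpoint iderive (f : V -> R) (s : seq V) : V -> R :=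
  if s is v :: s' then fun y => derive (iderive f s') y v else f.

Definition smooth (f : V -> R) : Prop :=
  forall s : seq V, continuous (iderive f s) /\
    forall (v y : V), derivable (iderive f s) y v.

Variable f : V -> R.
Definition coef_a (i : 'I_n.+1) : R := derive f 0 (ex i).
Definition coef_f2 (i j : 'I_n.+1) : R :=
  2^-1 * derive (fun y => derive f y (ex j)) 0 (ex i).
Definition coef_flam (i : 'I_n.+1) : R :=
  derive (fun y => derive f y elam) 0 (ex i).
Definition coef_ell : R := derive f 0 elam.
End Field.

Definition gamma (R : realType) (C : finType) (n : nat)
  (sigma : 'I_n.+1 -> C -> C) (f : V R n -> R) (x : C -> R) (lam : R) (p : C) : R :=
  f (\row_i x (sigma i p), lam).

(* Main.v *)
Require Import Defs.
From HB Require Import structures.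
From mathcomp Require Import all_boot all_order all_algebra.
From mathcomp Require Import all_classical all_reals all_analysis.
From mathcomp Require Import ring lra.
Set Implicit Arguments.
Unset Strict Implicit.
Unset Printing Implicit Defensive.
Import Order.TTheory GRing.Theory Num.Theory.
Import numFieldNormedType.Exports.
Local Open Scope classical_set_scope.
Local Open Scope ring_scope.

(** The network has no cycles, so the steady-state equations can be solved cell
    by cell from the maximal cells downwards, each time as one scalar equation
    [f (u + y e) = 0] in the state [y] of the new cell, [u] being the inputs and
    [e] the direction of its self-loops. With [s = (-l)^(2^-mu)], the unknown is
    sought as [y = D s + z s^2] with [|z| <= M]. A first-order Taylor expansion
    of [f] and of its derivative along [e] shows that for [M] large and [s]
    small the equation is strictly monotone in [z] and changes sign between
    [-M] and [M]; the zero is then unique, and continuous in [l].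
    A regular cell inherits the exponent of its inputs. A critical cell with an
    input outside [B] sees [A y^2] against inputs of size [s^2], which halves
    the exponent. A critical cell with all inputs in [B] has the synchronous
    solution [X l] as one zero; dividing it out leaves a transcritical equation
    for [y - X l]. *)

(** * Calculus from iterated directional derivatives *)

Section SmoothCalculus.
Variables (R : realType) (n : nat).
Implicit Types (f g : V R n -> R) (u v w y e : V R n).

(** The remainder asked for, [O(|lambda|^(2^-(mu-1)))], is [O(s^2)], so the bound [M] on [z] is
    itself the estimate to be proved. For [mu > 0] the power [s] is not differentiable at [l = 0],
    and the inputs are known only up to such errors; hence intermediate values and monotonicity for
    [l < 0] instead of an implicit function theorem at the origin. The choice of [M] looks circular:
    it has to beat the Taylor error, whose constant depends on the size of the window. But once
    [M s <= 1] the window lies in [|y| <= (|D| + 1) s], whatever [M] is. So the error constant is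
    fixed before [M], and the smallness of [s] after it. The network enters mainly through one fact:
    outside [B], the inputs other than the cell itself have depth at most [k], which is [mu] of the
    cell, less one if it is critical. Inputs of depth below [k] are of the order of the squared
    scale and vanish in the error. Hence only [Q_p] drives [D_p] when [k > 0], while at [k = 0] the
    parameter [lambda] has the size of the inputs and brings in [ell]. *)

Lemma smooth_derive f v : smooth f -> smooth (fun y => derive f y v).
Proof.
move=> sf s.
have -> : iderive (fun y => derive f y v) s = iderive f (rcons s v).
  by elim: s => //= a s ->.
exact: sf.
Qed.

Lemma smooth_continuous f : smooth f -> continuous f.
Proof. by move=> /(_ [::])[]. Qed.

Lemma smooth_derivable f v y : smooth f -> derivable f y v.
Proof. by move=> /(_ [::])[_]; apply. Qed.

Lemma is_derive_line f u v (t : R) : smooth f ->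
  is_derive t 1 (fun s : R => f (u + s *: v)) (derive f (u + t *: v) v).
Proof.
move=> sf.
have E : (fun h : R => h^-1 *: (((fun s : R => f (u + s *: v)) \o shift t) (h *: 1) -
            f (u + t *: v))) =
         (fun h : R => h^-1 *: ((f \o shift (u + t *: v)) (h *: v) - f (u + t *: v))).
  apply/funext => h /=; congr (_ *: (f _ - _)).
  by rewrite [h *: 1]mulr1 scalerDl addrCA.
have df : derivable f (u + t *: v) v by exact: smooth_derivable.
split; first by rewrite /derivable E.
by rewrite /derive E.
Qed.

Lemma line_MVT f u v : smooth f ->
  exists2 th : R, 0 <= th <= 1 & f (u + v) - f u = derive f (u + th *: v) v.
Proof.
move=> sf.
have cphi : {within `[0, 1], continuous (fun s : R => f (u + s *: v))}.
  apply: derivable_within_continuous => x _.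
  by have [] := is_derive_line u v x sf.
have [c c01] := @MVT R _ (fun t => derive f (u + t *: v) v) 0 1 ltr01
  (fun x _ => is_derive_line u v x sf) cphi.
rewrite scale1r scale0r addr0 subr0 mulr1 => ->.
by exists c => //; move: c01; rewrite in_itv/= => /andP[/ltW-> /ltW->].
Qed.

Lemma deriveZ_dir f y (c : R) v : smooth f -> derive f y (c *: v) = c * derive f y v.
Proof.
move=> sf.
have H1 := is_derive_line y (c *: v) 0 sf.
have H2 : is_derive (0 : R) 1 (fun s : R => f (y + (c *: s) *: v)) (c * derive f y v).
  have H3 := is_derive_line y v (c *: 0) sf.
  have H4 : is_derive (0 : R) 1 (fun s : R => c *: s) (c *: 1).
    exact: is_deriveZ.
  have := @is_derive1_comp _ (fun s : R => f (y + s *: v)) (fun s : R => c *: s) _ _ _ H3 H4.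
  by rewrite scaler0 scale0r addr0 [c *: 1]mulr1 mulrC.
have E : (fun s : R => f (y + s *: (c *: v))) = (fun s : R => f (y + (c *: s) *: v)).
  by apply/funext => s; rewrite scalerA mulrC.
rewrite E scale0r addr0 in H1.
have <- := @derive_val _ _ _ _ _ _ _ H1.
exact: (@derive_val _ _ _ _ _ _ _ H2).
Qed.

Lemma derive_quotient_cvg f y v : smooth f ->
  (fun h : R => h^-1 * (f (y + h *: v) - f y)) @ 0^' --> derive f y v.
Proof.
move=> sf.
have E : (fun h : R => h^-1 *: ((f \o shift y) (h *: v) - f y)) =
         (fun h : R => h^-1 * (f (y + h *: v) - f y)).
  by apply/funext => h /=; rewrite [_ + y]addrC.
have : derivable f y v by exact: smooth_derivable.
by rewrite /derivable /derive E.
Qed.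

(** [smooth] speaks of directional derivatives only, so additivity in the direction has to be
    earned: the quotients along [v + w] and [v] differ, by the mean value theorem, by the derivative
    along [w] at a point tending to [y], and that derivative is continuous. *)
Lemma deriveD_dir f y v w : smooth f ->
  derive f y (v + w) = derive f y v + derive f y w.
Proof.
move=> sf; apply/eqP; rewrite [eqbRHS]addrC -subr_eq; apply/eqP.
have H := @cvgB _ _ _ _ _ _ _ _ _ (@derive_quotient_cvg f y (v + w) sf)
  (@derive_quotient_cvg f y v sf).
pose q (h : R) : R := h^-1 * (f (y + h *: (v + w)) - f y) - h^-1 * (f (y + h *: v) - f y).
suff H' : q h @[h --> 0^'] --> derive f y w.
  apply: (@cvg_unique R^o _ (q h @[h --> 0^']) _ _ _ _ H') => //.
  exact: H.
rewrite /q.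
apply/cvgrPdist_le => eps eps0.
have /cvgrPdist_le/(_ _ eps0) := @smooth_continuous _ (@smooth_derive f w sf) y.
move=> /nbhs_normP[r /= r0 Hr].
near=> h.
have h0 : h != 0 by near: h; exact: nbhs_dnbhs_neq.
have [th /andP[th0 th1]] := line_MVT (y + h *: v) (h *: w) sf.
rewrite /= deriveZ_dir// -addrA -scalerDr => E.
have -> : h^-1 * (f (y + h *: (v + w)) - f y) - h^-1 * (f (y + h *: v) - f y) =
   derive f (y + h *: v + th *: (h *: w)) w.
  rewrite -mulrBr opprB addrA subrK E mulKf//.
apply: Hr; rewrite /ball_/= -!addrA opprD addNKr normrN scalerA.
apply: (le_lt_trans (ler_normD _ _)).
have -> : `|(th * h) *: w| = th * `|h| * `|w|.
  by rewrite [LHS]normrZ normrM (ger0_norm th0).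
have -> : `|h *: v| = `|h| * `|v| by exact: normrZ.
have : `|h| * (`|v| + `|w| + 1) < r.
  rewrite -ltr_pdivlMr//.
  near: h; apply: dnbhs0_lt; rewrite divr_gt0//.
apply: le_lt_trans.
rewrite mulrDr mulr1 mulrDr -addrA lerD2l.
rewrite -[leLHS]addr0 lerD// ler_wpM2r// -[leRHS]mul1r ler_wpM2r//.
Unshelve. all: by end_near.
Qed.

Lemma derive_sum_dir (I : Type) (r : seq I) (P : pred I) f y (c : I -> R) (v : I -> V R n) :
  smooth f ->
  derive f y (\sum_(i <- r | P i) c i *: v i) = \sum_(i <- r | P i) c i * derive f y (v i).
Proof.
move=> sf; elim: r => [|i r IH]; first by rewrite !big_nil derive0.
rewrite !big_cons; case: (P i) => //.
by rewrite deriveD_dir// deriveZ_dir// IH.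
Qed.

Lemma row_coord (x : 'I_n.+1 -> R) (l : R) :
  (\row_i x i, l) = \sum_i x i *: ex R i + l *: elam R n :> V R n.
Proof.
rewrite /ex /elam.
have -> : \sum_i x i *: ((delta_mx 0 i, 0) : V R n) = ((\sum_i x i *: delta_mx 0 i, 0) : V R n).
  elim/big_rec2: _ => // i y z _ ->.
  by apply: injective_projections => /=; rewrite ?scaler0 ?addr0.
apply: injective_projections; last by rewrite /= [_ *: _]mulr1 add0r.
rewrite /= scaler0 addr0 [LHS]row_sum_delta; apply: eq_bigr => i _.
by rewrite mxE.
Qed.

Lemma derive_coord f y w : smooth f ->
  derive f y w = \sum_i w.1 0 i * derive f y (ex R i) + w.2 * derive f y (elam R n).
Proof.
move=> sf.
have E : w = \sum_i w.1 0 i *: ex R i + w.2 *: elam R n.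
  rewrite -row_coord; apply: injective_projections => //=.
  by apply/rowP => i; rewrite mxE.
by rewrite {1}E deriveD_dir// derive_sum_dir// deriveZ_dir.
Qed.

Lemma norm_coord1 w i : `|w.1 0 i| <= `|w|.
Proof.
rewrite prod_normE le_max; apply/orP; left.
rewrite /Num.norm/= mx_normrE.
by apply: (@le_bigmax _ _ _ _ (fun ij => `|w.1 ij.1 ij.2|) (0, i)).
Qed.

Lemma norm_coord2 w : `|w.2| <= `|w|.
Proof. by rewrite prod_normE le_max lexx orbT. Qed.

Lemma le_sum_coord w (F : 'I_n.+1 -> R) (G r : R) (F' : 'I_n.+1 -> R) (G' : R) :
  `|w| <= r -> (forall i, `|F i| <= F' i) -> `|G| <= G' ->
  `|\sum_i w.1 0 i * F i + w.2 * G| <= (\sum_i F' i + G') * r.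
Proof.
move=> wr HF HG; rewrite mulrDl mulr_suml.
apply: (le_trans (ler_normD _ _)); apply: lerD.
  apply: (le_trans (ler_norm_sum _ _ _)); apply: ler_sum => i _.
  by rewrite normrM mulrC ler_pM// (le_trans (norm_coord1 _ _)).
by rewrite normrM mulrC ler_pM// (le_trans (norm_coord2 _)).
Qed.

Lemma near0_forall (I : finType) (P : I -> V R n -> Prop) :
  (forall i, \forall y \near (0 : V R n), P i y) ->
  \forall y \near (0 : V R n), forall i, P i y.
Proof. exact: (@filter_forall _ I P (nbhs (0 : V R n)) (nbhs_filter _)). Qed.

Lemma near0_and (P Q : V R n -> Prop) :
  (\forall y \near (0 : V R n), P y) -> (\forall y \near (0 : V R n), Q y) ->
  exists2 r : R, 0 < r & forall y, `|y| < r -> P y /\ Q y.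
Proof.
move=> HP HQ.
have H : \forall y \near (0 : V R n), P y /\ Q y by exact: filterI.
have /nbhs_normP[r /= r0 Hr] := H.
exists r => // y yr; apply: Hr.
by rewrite /ball_/= sub0r normrN.
Qed.

(** Mean value theorem on the segment from [0] to [w], where the partial derivatives are bounded by
    continuity. *)
Lemma smooth_lipschitz0 f : smooth f ->
  exists2 C, 0 <= C & \forall w \near (0 : V R n), `|f w - f 0| <= C * `|w|.
Proof.
move=> sf.
have B v : \forall y \near (0 : V R n), `|derive f y v| <= `|derive f 0 v| + 1.
  have /cvgrPdist_le/(_ _ ltr01) := @smooth_continuous _ (@smooth_derive f v sf) 0.
  apply: filterS => y; rewrite distrC => H.
  rewrite -lerBlDl; apply: le_trans H; exact: lerB_dist.
have Be : \forall y \near (0 : V R n), forall i, `|derive f y (ex R i)| <= `|derive f 0 (ex R i)| + 1.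
  by apply: near0_forall => i; exact: B.
exists (\sum_i (`|derive f 0 (ex R i)| + 1) + (`|derive f 0 (elam R n)| + 1)).
  by rewrite addr_ge0// sumr_ge0// => i _; rewrite addr_ge0.
have [r r0 Hr] := near0_and Be (B (elam R n)).
apply/nbhs_normP; exists r => //= w; rewrite /ball_/= sub0r normrN => wr.
have [th /andP[th0 th1]] := line_MVT 0 w sf.
rewrite !add0r => ->; rewrite derive_coord//.
have [|H1 H2] := Hr (th *: w).
  rewrite [X in X < _]normrZ ger0_norm//.
  by apply: le_lt_trans wr; rewrite -[leRHS]mul1r ler_wpM2r.
exact: le_sum_coord.
Qed.

(** By the mean value theorem the remainder is a difference of derivatives along [w]; the partial
    derivatives are Lipschitz at [0], which gives the second factor [|w|]. *)
Lemma smooth_taylor1 f : smooth f ->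
  exists2 C, 0 <= C & \forall w \near (0 : V R n),
    `|f w - f 0 - derive f 0 w| <= C * `|w| ^+ 2.
Proof.
move=> sf.
have /choice[Ci HCi] : forall i : 'I_n.+1, exists c : R, 0 <= c /\
    \forall w \near (0 : V R n), `|derive f w (ex R i) - derive f 0 (ex R i)| <= c * `|w|.
  move=> i.
  by have [c c0 Hc] := smooth_lipschitz0 (@smooth_derive f (ex R i) sf); exists c.
have [Cl Cl0 HCl] := smooth_lipschitz0 (@smooth_derive f (elam R n) sf).
have HC : \forall w \near (0 : V R n), forall i,
    `|derive f w (ex R i) - derive f 0 (ex R i)| <= Ci i * `|w|.
  by apply: near0_forall => i; case: (HCi i).
exists (\sum_i Ci i + Cl).
  by rewrite addr_ge0// sumr_ge0// => i _; case: (HCi i).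
have [r r0 Hr] := near0_and HC HCl.
apply/nbhs_normP; exists r => //= w; rewrite /ball_/= sub0r normrN => wr.
have [th /andP[th0 th1]] := line_MVT 0 w sf.
rewrite !add0r => ->; rewrite (derive_coord (th *: w))// (derive_coord 0)//.
have E : `|th *: w| <= `|w|.
  by rewrite [leLHS]normrZ ger0_norm// -[leRHS]mul1r ler_wpM2r.
have [|H1 H2] := Hr (th *: w).
  exact: le_lt_trans wr.
rewrite opprD addrACA -mulrBr -sumrB.
rewrite (eq_bigr (fun i => w.1 0 i * (derive f (th *: w) (ex R i) - derive f 0 (ex R i)))); last first.
  by move=> i _; rewrite mulrBr.
rewrite expr2 mulrA mulrDl mulr_suml.
apply: le_sum_coord => //.
  move=> i; apply: (le_trans (H1 i)); rewrite ler_wpM2l//; by case: (HCi i).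
by apply: (le_trans H2); rewrite ler_wpM2l.
Qed.

(** The mean value theorem twice: along [v] for the difference of [f] on two parallel segments, then
    along [w] for the derivative along [v]. *)
Lemma second_difference f v w (h : R) : smooth f ->
  exists th th' : R, [/\ 0 <= th <= 1, 0 <= th' <= 1 &
    f (h *: v + h *: w) - f (h *: v) - f (h *: w) + f 0 =
    h * (h * derive (fun y => derive f y v) (th *: (h *: v) + th' *: (h *: w)) w)].
Proof.
move=> sf.
pose df (t : R) : R := derive f (h *: w + t *: (h *: v)) (h *: v) - derive f (0 + t *: (h *: v)) (h *: v).
have D (t : R) : is_derive t (1 : R) (fun s : R => f (h *: w + s *: (h *: v)) - f (0 + s *: (h *: v)) : R) (df t).
  apply: is_deriveB; exact: is_derive_line.
have cphi : {within `[0, 1], continuous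
   (fun s : R => f (h *: w + s *: (h *: v)) - f (0 + s *: (h *: v)))}.
  by apply: derivable_within_continuous => x _; have [] := D x.
have [c c01] := @MVT R _ df 0 1 ltr01 (fun x _ => D x) cphi.
rewrite !scale1r !scale0r !addr0 subr0 mulr1 /df !add0r !deriveZ_dir// -mulrBr.
have [th' th'01] := line_MVT (c *: (h *: v)) (h *: w) (@smooth_derive f v sf).
rewrite [c *: _ + h *: _]addrC deriveZ_dir; last exact: smooth_derive.
move=> -> E; exists c, th'; split => //.
  by move: c01; rewrite in_itv/= => /andP[/ltW-> /ltW->].
by rewrite -E [h *: v + _]addrC opprB; ring.
Qed.

Lemma dist_le_half (x1 x2 z e : R) :
  `|x1 - z| <= e / 2 -> `|x2 - z| <= e / 2 -> `|x1 - x2| <= e.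
Proof. by rewrite !ler_norml => /andP[? ?] /andP[? ?]; apply/andP; split; lra. Qed.

(** The second difference is symmetric in [v] and [w]. Divided by [h^2] it equals each mixed
    derivative at some point near [0]; continuity does the rest. *)
Lemma schwarz f v w : smooth f ->
  derive (fun y => derive f y v) 0 w = derive (fun y => derive f y w) 0 v.
Proof.
move=> sf; apply/eqP; rewrite -subr_eq0 -normr_le0; apply/ler_addgt0Pl => e e0; rewrite addr0.
have e20 : 0 < e / 2 by rewrite divr_gt0.
have /cvgrPdist_le/(_ _ e20) H1 := @smooth_continuous _ (smooth_derive w (@smooth_derive f v sf)) 0.
have /cvgrPdist_le/(_ _ e20) H2 := @smooth_continuous _ (smooth_derive v (@smooth_derive f w sf)) 0.
have [r r0 Hr] := near0_and H1 H2.
(* With this [h] every intermediate point of the two second differences has norm below [r]. *)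
pose h := r / (`|v| + `|w| + 1).
have N0 : 0 < `|v| + `|w| + 1 by rewrite ltr_wpDl// addr_ge0.
have h0 : 0 < h by rewrite divr_gt0.
have small (a b : R) (v' w' : V R n) : `|v'| + `|w'| = `|v| + `|w| ->
   0 <= a <= 1 -> 0 <= b <= 1 -> `|a *: (h *: v') + b *: (h *: w')| < r.
  move=> vw /andP[a0 a1] /andP[b0 b1].
  apply: (le_lt_trans (ler_normD _ _)).
  have -> : `|a *: (h *: v')| = a * (h * `|v'|).
    by rewrite [LHS]normrZ [X in _ * X]normrZ !ger0_norm// ltW.
  have -> : `|b *: (h *: w')| = b * (h * `|w'|).
    by rewrite [LHS]normrZ [X in _ * X]normrZ !ger0_norm// ltW.
  have -> : r = h * (`|v| + `|w| + 1) by rewrite /h divfK// gt_eqF.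
  rewrite -vw !mulrDr mulr1.
  have A : a * (h * `|v'|) <= h * `|v'| by rewrite -[leRHS]mul1r ler_wpM2r// mulr_ge0// ltW.
  have A' : b * (h * `|w'|) <= h * `|w'| by rewrite -[leRHS]mul1r ler_wpM2r// mulr_ge0// ltW.
  by lra.
have [a [b [a01 b01 Ea]]] := second_difference v w h sf.
have [a' [b' [a01' b01' Eb]]] := second_difference w v h sf.
have E : derive (fun y => derive f y v) (a *: (h *: v) + b *: (h *: w)) w =
         derive (fun y => derive f y w) (a' *: (h *: w) + b' *: (h *: v)) v.
  rewrite [h *: w + h *: v]addrC in Eb.
  have aux (x1 x2 p q s t : R) : p - q - s + t = h * (h * x1) ->
      p - s - q + t = h * (h * x2) -> x1 = x2.
    move=> E1 E2; apply: (mulfI (lt0r_neq0 h0)); apply: (mulfI (lt0r_neq0 h0)).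
    by rewrite -E1 -E2; ring.
  exact: aux Ea Eb.
have [|A1 _] := Hr (a *: (h *: v) + b *: (h *: w)).
  exact: (small a b v w erefl a01 b01).
have [|_ A2] := Hr (a' *: (h *: w) + b' *: (h *: v)).
  exact: (small a' b' w v (addrC _ _) a01' b01').
rewrite /= -E in A2.
exact: dist_le_half A1 A2.
Qed.
End SmoothCalculus.

(** * Zeros of a monotone family *)

Section ImplicitBranch.
Variable R : realType.
Implicit Types (d M : R).

(* Strict monotonicity in [z] makes separate continuity in [l] sufficient. *)
Lemma continuous_zero (H : R -> R -> R) d M : 0 < M ->
  (forall l : R, - d < l < 0 -> forall z : R, - M <= z <= M -> {for l, continuous (H^~ z)}) ->
  (forall l : R, - d < l < 0 -> continuous (H l)) ->
  (forall l : R, - d < l < 0 -> forall z z' : R, - M <= z -> z < z' -> z' <= M -> H l z < H l z') ->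
  (forall l : R, - d < l < 0 -> H l (- M) < 0 < H l M) ->
  exists zeta : R -> R, forall l, - d < l < 0 ->
    [/\ {for l, continuous zeta}, `|zeta l| <= M & H l (zeta l) = 0].
Proof.
move=> M0 cl cz incr sgn.
have ex l : exists z, - d < l < 0 -> - M < z < M /\ H l z = 0.
  have [dl|] := boolP (- d < l < 0); last by exists 0.
  have /andP[s1 s2] := sgn l dl.
  have MM : - M <= M by lra.
  have [|c] := @IVT R (H l) _ _ 0 MM (continuous_subspaceT (cz l dl)).
    rewrite minElt maxElt (lt_trans s1 s2); by rewrite !ltW.
  rewrite in_itv/= => /andP[c1 c2] c0; exists c => _; split => //.
  rewrite !lt_neqAle c1 c2 !andbT; apply/andP; split; apply/eqP => E.
    by move: s1; rewrite E c0 ltxx.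
  by move: s2; rewrite -E c0 ltxx.
have /choice[zeta Hz] := ex.
exists zeta => l dl; have [/andP[zl zr] z0] := Hz l dl.
split => //; last by rewrite ler_norml !ltW.
have /andP[dl1 dl2] := dl.
apply/cvgrPdist_le => e e0.
(* An [e]-interval around the zero, cut to the window. The signs of [H] at its ends persist for [t]
   near [l], and monotonicity then confines [zeta t] to it. *)
pose lo := Num.max (zeta l - e) (- M); pose hi := Num.min (zeta l + e) M.
have lo1 : - M <= lo by rewrite le_max lexx orbT.
have lo2 : lo < zeta l by rewrite gt_max zl andbT; lra.
have hi1 : hi <= M by rewrite ge_min lexx orbT.
have hi2 : zeta l < hi by rewrite lt_min zr andbT; lra.
have Hlo : H l lo < 0 by rewrite -z0; apply: incr => //; exact: ltW.
have Hhi : 0 < H l hi by rewrite -z0; apply: incr => //; exact: ltW.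
have lo3 : - M <= lo <= M by lra.
have hi3 : - M <= hi <= M by lra.
have N1 : \forall t \near l, H t lo < 0.
  have := cl l dl lo lo3; move/cvgr_lt; exact.
have N2 : \forall t \near l, 0 < H t hi.
  have := cl l dl hi hi3; move/cvgr_gt; exact.
have N3 : \forall t \near l, - d < t by apply: filterS (lt_le_nbhsr (_ : (- d + l) / 2 < l)) => [t|]; lra.
have N4 : \forall t \near l, t < 0 by exact: lt_nbhsl.
near=> t.
have dt : - d < t < 0 by apply/andP; split; near: t.
have [/andP[zt1 zt2] zt0] := Hz t dt.
have t1 : H t lo < 0 by near: t.
have t2 : 0 < H t hi by near: t.
have A : lo <= zeta t.
  rewrite leNgt; apply/negP => /(incr t dt _ _ (ltW zt1)) /(_ (ltac:(lra))).
  by rewrite zt0 ltNge (ltW t1).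
have B : zeta t <= hi.
  rewrite leNgt; apply/negP => h; have := incr t dt _ _ _ h (ltW zt2).
  rewrite zt0 => /(_ (ltac:(lra))).
  by rewrite ltNge (ltW t2).
move: A B; rewrite ge_max le_min => /andP[A _] /andP[B _].
rewrite ler_distl; lra.
Unshelve. all: by end_near.
Qed.

End ImplicitBranch.

(** * Reachability and critical depth in a feedforward network *)

Section Network.
Variables (C : finType) (n : nat) (sigma : 'I_n.+1 -> C -> C).
Hypothesis ff : feedforward sigma.

Local Notation conn := (connect (arrow sigma)).

Lemma arrow_sigma i p : arrow sigma (sigma i p) p.
Proof. by apply/existsP; exists i. Qed.

Lemma is_path_connect p q s : is_path sigma p q s -> conn p q.
Proof.
case: s => //= x s /and4P[/eqP<- /eqP<- ps _].
by apply/connectP; exists s.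
Qed.

Lemma connect_is_path p q : conn p q -> exists s, is_path sigma p q s.
Proof.
case/connectP => s ps ->; case/shortenP: ps => s' ps' us' _.
by exists (p :: s') => /=; move: us' => /= us'; rewrite !eqxx ps' us'.
Qed.

(** A duplicate-free path with at least two cells, closed by the arrow, would be a forbidden
    cycle. *)
Lemma connect_arrow_eq p q : conn p q -> arrow sigma q p -> p = q.
Proof.
case/connectP => s ps ->; case/shortenP: ps => -[|y s'] //= ps' us' _ aqp.
have := @ff p (last y s') (p :: y :: s').
by move: us' => /= us'; rewrite /= !eqxx ps' us' aqp => /(_ isT isT).
Qed.

Lemma connect_last p q : conn p q -> p != q ->
  exists2 r, conn p r & arrow sigma r q && (r != q).
Proof.
case/connectP => s ps ->; case/shortenP: ps => s'.
case/lastP: s' => [|s' x]; first by rewrite eqxx.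
rewrite rcons_path last_rcons -rcons_cons rcons_uniq => /andP[ps' a] /andP[nx _] _ _.
exists (last p s'); first by apply/connectP; exists s'.
by rewrite a; apply: contraNneq nx => <-; rewrite mem_last.
Qed.

(** The last arrow [r -> q] of a path from [p] to [q] would close a cycle, since [q] reaches [r]
    through [p]. *)
Lemma connect_anti p q : conn p q -> conn q p -> p = q.
Proof.
move=> pq qp; apply/eqP; apply/negPn/negP => pnq.
have [r pr /andP[rq /eqP nrq]] := connect_last pq pnq.
by apply: nrq; symmetry; apply: connect_arrow_eq rq; exact: connect_trans qp pr.
Qed.

Lemma trleP p q : reflect (conn q p) (trle sigma p q).
Proof.
apply: (iffP existsP) => [[k /existsP[t]]|/connect_is_path[s hs]].
  exact: is_path_connect.
have us : uniq s by case: s hs => //= x s /and4P[_ _ _].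
have ks : (size s < #|C|.+1)%N by rewrite ltnS -(card_uniqP us) max_card.
by exists (Ordinal ks); apply/existsP; exists (in_tuple s).
Qed.

Lemma trgtP q p : reflect (conn q p /\ q != p) (trgt sigma q p).
Proof.
rewrite /trgt eq_sym; apply: (iffP andP) => -[/trleP ? ?]; split => //; exact/trleP.
Qed.

(** Among the cells of [P] above [p0] take one with fewest ancestors: by antisymmetry a proper
    ancestor has strictly fewer. *)
Lemma exists_topmost (P : pred C) p0 : P p0 ->
  exists2 p, P p & conn p p0 /\ forall q, conn q p -> q != p -> ~~ P q.
Proof.
move=> P0.
pose anc p := #|[pred q | conn q p]|.
have Q0 : P p0 && conn p0 p0 by rewrite P0 connect0.
case: (@arg_minnP C p0 (fun p => P p && conn p p0) anc Q0) => p /andP[Pp pp0] pmin.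
exists p => //; split => // q qp qnp; apply/negP => Pq.
have := pmin q; rewrite Pq (connect_trans qp pp0) => /(_ isT).
apply/negP; rewrite -ltnNge; apply: proper_card; apply/properP; split.
  by apply/fintype.subsetP => r; rewrite !inE => /connect_trans; apply.
exists p; first by rewrite /= inE connect0.
by rewrite /= inE; apply: contraNN qnp => /(connect_anti qp)->.
Qed.

Lemma exists_maximal (p0 : C) : exists p, maximal sigma p.
Proof.
have [p _ [_ H]] := @exists_topmost predT p0 isT.
exists p; apply/forallP => i; apply/negPn/negP => h.
by have := H (sigma i p) (connect1 (arrow_sigma i p)) h.
Qed.

Variables (R : realType) (a : 'I_n.+1 -> R) (B : {set C}).
Hypothesis rootB : root_subnetwork sigma a B.

Local Notation crit := (critical sigma a).
Local Notation m := (mu sigma a B).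

Let cnt (s : seq C) := count (fun q => crit q && (q \notin B)) s.

(** The maximum inside [mu] before [1] is subtracted; working with it postpones truncated
    subtraction until [mu_notin]. *)
Definition critical_depth p : nat :=
  \max_(k < #|C|.+1)
     \max_(t : (k : nat).-tuple C | [exists pb in B, is_path sigma pb p t])
        cnt t.

Lemma le_critical_depth p pb s : pb \in B -> is_path sigma pb p s ->
  (cnt s <= critical_depth p)%N.
Proof.
move=> pbB hs.
have us : uniq s by case: s hs => //= x s /and4P[_ _ _].
have ks : (size s < #|C|.+1)%N by rewrite ltnS -(card_uniqP us) max_card.
rewrite /critical_depth.
apply: leq_trans (leq_bigmax (Ordinal ks)).
apply: leq_trans (leq_bigmax_cond (in_tuple s) _) => //.
by apply/existsP; exists pb; rewrite pbB.
Qed.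

Lemma critical_depth_le p N :
  (forall pb s, pb \in B -> is_path sigma pb p s -> (cnt s <= N)%N) ->
  (critical_depth p <= N)%N.
Proof.
move=> H; apply/bigmax_leqP => k _; apply/bigmax_leqP => t /existsP[pb /andP[pbB]].
exact: H.
Qed.

Lemma sub_closed i p : p \in B -> sigma i p \in B.
Proof. by case: rootB => -[_ H] _ _ _; exact: H. Qed.

Lemma connect_closed p q : conn p q -> q \in B -> p \in B.
Proof.
case/connectP => s ps ->; elim: s p ps => //= y s IH p /andP[/existsP[i /eqP<-] ps] lB.
exact/sub_closed/IH.
Qed.

(** A path ending in [B] lies in [B], by closure under inputs, and cells of [B] are not counted. *)
Lemma critical_depth_in p : p \in B -> critical_depth p = 0%N.
Proof.
move=> pB; apply/eqP; rewrite -leqn0; apply: critical_depth_le => pb s _.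
case: s => //= x s /and4P[/eqP _ /eqP lx ps _].
suff : all (mem B) (x :: s).
  move=> /allP H; rewrite -[leqLHS]/(cnt (x :: s)) leqNgt /cnt -has_count.
  by apply/hasPn => z /H /= ->; rewrite andbF.
have : last x s \in B by rewrite lx.
elim: s x {lx} ps => [|y s IH] x /=; first by move=> _ ->.
move=> /andP[/existsP[i /eqP<-] ps] lB; have /andP[yB sB] := IH _ ps lB.
by apply/and3P; split => //; exact: sub_closed.
Qed.

Lemma reach_root p : exists2 pb, pb \in B & connect (arrow sigma) pb p.
Proof.
have [q _ [qp H]] := @exists_topmost predT p isT.
exists q => //; case: rootB => _ _ maxB _; apply: maxB.
apply/forallP => i; apply/negPn/negP => h.
by have := H (sigma i q) (connect1 (arrow_sigma i q)) h.
Qed.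

(** [p] cannot occur on the path already: it would reach [q], and the arrow from [q] to [p] would
    close a cycle. *)
Lemma is_path_rcons pb q p s : is_path sigma pb q s -> arrow sigma q p -> q != p ->
  is_path sigma pb p (rcons s p).
Proof.
move=> hs qp nqp.
have ps : p \notin s.
  apply/negP => pins; move/negP: nqp; apply; rewrite eq_sym; apply/eqP.
  apply: connect_arrow_eq qp; case: s hs pins => //= x s /and4P[_ /eqP lx hs _] pin.
  case/splitPl: pin hs lx => s1 s2 <-; rewrite cat_path last_cat => /andP[_ h] <-.
  by apply/connectP; exists s2.
case: s hs ps => //= x s /and4P[/eqP-> /eqP lx hs us] nps.
move: us nps => /andP[us1 us2]; rewrite inE negb_or => /andP[n1 n2].
by rewrite !eqxx last_rcons eqxx rcons_path hs lx qp mem_rcons inE negb_or eq_sym n1 us1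
  rcons_uniq n2 us2.
Qed.

Lemma critical_depth_arrow q p : arrow sigma q p -> q != p -> p \notin B ->
  (critical_depth q + crit p <= critical_depth p)%N.
Proof.
move=> qp nqp pB.
have H pb s : pb \in B -> is_path sigma pb q s -> (cnt s + crit p <= critical_depth p)%N.
  move=> pbB hs; have := le_critical_depth pbB (is_path_rcons hs qp nqp).
  by rewrite /cnt -cats1 count_cat /= pB andbT addn0.
(* Some path from [B] to [q] exists; this makes the subtraction of [crit p] below exact. *)
have cp : (crit p <= critical_depth p)%N.
  have [pb pbB /connect_is_path[s hs]] := reach_root q.
  by apply: leq_trans (H _ _ pbB hs); exact: leq_addl.
rewrite -(subnK cp) leq_add2r; apply: critical_depth_le => pb s pbB hs.
by have := H _ _ pbB hs; rewrite -{1}(subnK cp) leq_add2r.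
Qed.

(** Converse of [critical_depth_arrow]: a path from [B] to [p] has a last but one cell, because [p]
    is not in [B], and dropping [p] loses exactly [crit p]. *)
Lemma critical_depth_le_inputs p N : p \notin B ->
  (forall q, arrow sigma q p -> q != p -> (critical_depth q + crit p <= N)%N) ->
  (critical_depth p <= N)%N.
Proof.
move=> pB H; apply: critical_depth_le => pb s pbB.
case: s => // x s /= /and4P[/eqP-> /eqP lx hs /andP[us1 us2]].
case/lastP: s lx hs us1 us2 => [/= E|s y].
  by move: pB; rewrite -E pbB.
rewrite last_rcons => ->; rewrite rcons_path rcons_uniq mem_rcons inE negb_or.
move=> /andP[hs ap] /andP[n1 n2] /andP[n3 n4].
have nl : last pb s != p.
  apply/eqP => E; have := mem_last pb s; rewrite E inE (negbTE n3) orbF.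
  by rewrite eq_sym (negbTE n1).
have hq : is_path sigma pb (last pb s) (pb :: s) by rewrite /= !eqxx hs n2 n4.
apply: leq_trans (H _ ap nl).
have := le_critical_depth pbB hq; rewrite -(leq_add2r (crit p)); apply: leq_trans.
by rewrite /cnt /= -cats1 count_cat /= pB andbT addn0 addnA.
Qed.

Lemma critical_depth_connect q p : conn q p -> (critical_depth q <= critical_depth p)%N.
Proof.
case/connectP => s hs ->; elim: s q hs => //= y s IH q /andP[qy hs].
apply: leq_trans (IH _ hs).
have [->//|nqy] := eqVneq q y.
have [yB|yB] := boolP (y \in B).
  case/existsP: qy => i /eqP<-; rewrite !critical_depth_in// sub_closed//.
by apply: leq_trans (critical_depth_arrow qy nqy yB); rewrite leq_addr.
Qed.

(** The root condition enters here: a topmost ancestor outside [B] has all its proper ancestors in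
    [B], hence is critical; it is not maximal, so a path reaches it through an input and counts
    it. *)
Lemma critical_depth_gt0 p : p \notin B -> (0 < critical_depth p)%N.
Proof.
move=> pB.
have [q qB [qp H]] := @exists_topmost (fun q => q \notin B) p pB.
apply: leq_trans (critical_depth_connect qp).
have [_ _ maxB critB] := rootB.
have cq : crit q.
  apply: critB => // r /trgtP[rq nrq]; exact/negPn/(H r).
have : ~~ maximal sigma q by apply: contraNN qB; exact: maxB.
move=> /forallPn[i hi].
have := critical_depth_arrow (arrow_sigma i q) hi qB.
by rewrite cq addn1; exact: leq_trans.
Qed.

Lemma mu_in p : p \in B -> m p = 0%N.
Proof. by rewrite /mu => ->. Qed.

Lemma mu_notin p : p \notin B -> (m p).+1 = critical_depth p.
Proof.
by move=> pB; rewrite /mu (negbTE pB) subn1 prednK// critical_depth_gt0.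
Qed.

Lemma mu_connect q p : conn q p -> (m q <= m p)%N.
Proof.
move=> qp; have [qB|qB] := boolP (q \in B); first by rewrite mu_in.
have pB : p \notin B by apply: contraNN qB; exact: connect_closed.
by rewrite -ltnS !mu_notin// critical_depth_connect.
Qed.

(** Let [r] be the last cell before [p]. Outside [B], the arrow from [r] adds [crit p]; in [B], [mu]
    is [0]. The truncated difference is right for a critical [p] with [mu p = 0], since then [r]
    lies in [B]. *)
Lemma mu_trgt q p : p \notin B -> trgt sigma q p -> (m q <= m p - crit p)%N.
Proof.
move=> pB /trgtP[qp nqp].
have [r qr /andP[rp nrp]] := connect_last qp nqp.
apply: leq_trans (mu_connect qr) _.
have [rB|rB] := boolP (r \in B); first by rewrite mu_in.
have := critical_depth_arrow rp nrp pB; rewrite -!mu_notin// addSn ltnS => h.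
by rewrite -(leq_add2r (crit p)) subnK// (leq_trans _ h)// leq_addl.
Qed.

Lemma trgt_sigma i p : sigma i p != p -> trgt sigma (sigma i p) p.
Proof. by move=> h; apply/trgtP; split => //; exact/connect1/arrow_sigma. Qed.

Lemma mu_input_le i p : p \notin B -> sigma i p != p -> (m (sigma i p) <= m p - crit p)%N.
Proof. by move=> pB /trgt_sigma; exact: mu_trgt. Qed.

(** If every proper ancestor stayed below the bound of [mu_trgt], [critical_depth_le_inputs] would
    give a critical depth of at most [m p], one too few. *)
Lemma bigmax_mu p : p \notin B -> (0 < m p - crit p)%N ->
  \max_(s | trgt sigma s p) m s = (m p - crit p)%N.
Proof.
move=> pB k0; apply/eqP; rewrite eqn_leq; apply/andP; split.
  by apply/bigmax_leqP => s; exact: mu_trgt.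
rewrite leqNgt; apply/negP => lt.
have cm : (crit p <= m p)%N by rewrite ltnW// -subn_gt0.
suff : (critical_depth p <= m p)%N by rewrite -mu_notin// ltnn.
apply: critical_depth_le_inputs => // q qp nqp.
have [qB|qB] := boolP (q \in B); first by rewrite critical_depth_in.
rewrite -mu_notin// -(subnK cm) leq_add2r; apply: leq_ltn_trans lt.
by apply: leq_bigmax_cond; apply/trgtP; split => //; exact: connect1.
Qed.

Lemma inQE i p : p \notin B -> (0 < m p - crit p)%N ->
  inQ sigma a B p (sigma i p) = (sigma i p != p) && (m (sigma i p) == m p - crit p)%N.
Proof.
move=> pB k0; rewrite /inQ bigmax_mu//.
by have -> : [exists i0, sigma i0 p == sigma i p] by apply/existsP; exists i.
Qed.

(** An input outside [B] has critical depth at least [1], and [p] adds one, which would make [mu p]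
    positive. *)
Lemma input_of_first_critical i p : p \notin B -> crit p -> m p = 0%N -> sigma i p != p ->
  sigma i p \in B.
Proof.
move=> pB cp mp ip; apply/negPn/negP => qB.
have := critical_depth_arrow (arrow_sigma i p) ip pB.
by rewrite -!mu_notin// mp cp addn1.
Qed.

Lemma next_cell (S : {set C}) : (exists p, p \notin S) ->
  exists2 p, p \notin S & forall i, sigma i p != p -> sigma i p \in S.
Proof.
case=> p0 p0S; have [p pS [_ H]] := @exists_topmost (fun q => q \notin S) p0 p0S.
exists p => // i ip; apply/negPn; exact: H (connect1 (arrow_sigma i p)) ip.
Qed.

End Network.

(** * Powers of [-l] with dyadic exponents *)

Section Scales.
Variable R : realType.

Definition scale (k : nat) (l : R) : R := (- l) `^ (2 ^+ k)^-1.

Lemma scale0 l : l < 0 -> scale 0 l = - l.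
Proof. by move=> l0; rewrite /scale expr0 invr1 powRr1// oppr_ge0 ltW. Qed.

Lemma scale_gt0 k l : l < 0 -> 0 < scale k l.
Proof. by move=> l0; rewrite /scale powR_gt0// oppr_gt0. Qed.

Lemma scale_sqr k l : l < 0 -> scale k l ^+ 2 = `|l| `^ (2 / 2 ^+ k).
Proof.
move=> l0; rewrite /scale -powR_mulrn; last exact: powR_ge0.
by rewrite -powRrM ltr0_norm// mulrC.
Qed.

Lemma scaleS k l : l < 0 -> scale k.+1 l ^+ 2 = scale k l.
Proof.
move=> l0; rewrite scale_sqr// ltr0_norm// /scale exprS invfM mulrA divff ?mul1r//.
Qed.

Lemma scale_le1 k l : - 1 < l < 0 -> scale k l <= 1.
Proof.
move=> /andP[l1 l0].
elim: k => [|k IH]; first by rewrite scale0//; lra.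
have := scaleS k l0; have := scale_gt0 k.+1 l0; nra.
Qed.

(** Consecutive scales are related by an exact square, and scales at most [1] grow with [k]. Inputs
    of lower depth thus have the size of the error term. *)
Lemma le_scale_sqr j k l : - 1 < l < 0 -> (j < k)%N -> scale j l <= scale k l ^+ 2.
Proof.
move=> l10; have /andP[_ l0] := l10; elim: k => // k IH; rewrite ltnS leq_eqVlt.
rewrite scaleS// => /orP[/eqP->//|/IH h]; apply: (le_trans h).
have := scale_gt0 k l0; have := scale_le1 k l10; nra.
Qed.

Lemma scale_small k r : 0 < r -> exists2 d : R, 0 < d & forall l, - d < l < 0 -> scale k l < r.
Proof.
elim: k r => [|k IH] r r0.
  exists r => // l /andP[l1 l2]; rewrite scale0//; lra.
have [|d d0 Hd] := IH (r ^+ 2); first by rewrite exprn_gt0.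
exists d => // l dl; have /andP[_ l0] := dl.
have := Hd l dl; rewrite -scaleS//.
by rewrite ltr_pXn2r// ?nnegrE ltW// scale_gt0.
Qed.

Lemma scale_continuous k l : l < 0 -> {for l, continuous (scale k)}.
Proof.
move=> l0; rewrite /scale.
have A : {for - l, continuous (fun x : R => x `^ (2 ^+ k)^-1)}.
  apply: differentiable_continuous; apply/derivable1_diffP.
  by apply: derivable_powR; rewrite in_itv/= andbT oppr_gt0.
have B : {for l, continuous (fun x : R => - x)} by exact: continuousN.
exact: (@continuous_comp _ _ _ (fun x : R => - x) (fun x : R => x `^ (2 ^+ k)^-1) l B A).
Qed.

End Scales.

(** * The equation of one cell and its solution in the window *)

Section CellEquation.
Variables (R : realType) (n : nat) (f : V R n -> R).
Hypothesis sf : smooth f.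
Implicit Types (u e w : V R n).

Lemma taylor1_at f0 : smooth f0 -> exists C r : R, [/\ 0 <= C, 0 < r &
  forall w (rho : R), `|w| <= rho -> rho < r ->
    `|f0 w - f0 0 - derive f0 0 w| <= C * rho ^+ 2].
Proof.
move=> sf0; have [C C0 HC] := smooth_taylor1 sf0.
have [r r0 Hr] := near0_and HC HC.
exists C, r; split => // w rho wrho rhor.
have [h _] := Hr w (le_lt_trans wrho rhor); apply: (le_trans h).
by rewrite ler_wpM2l// ler_sqr// nnegrE// (le_trans _ wrho).
Qed.

Lemma derive_lipschitz0 f0 : smooth f0 -> exists2 C : R, 0 <= C &
  forall w, `|derive f0 0 w| <= C * `|w|.
Proof.
move=> sf0; exists (\sum_i `|derive f0 0 (ex R i)| + `|derive f0 0 (elam R n)|).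
  by rewrite addr_ge0// sumr_ge0.
by move=> w; rewrite derive_coord//; exact: le_sum_coord.
Qed.

Local Notation g e := (fun y => derive f y e).

(* Taylor along the line [u + t e]; only [derive f . e] is expanded at the
   origin, so that exact zeros of [f] at the base point [u] can be exploited. *)
Lemma taylor_line e : exists C r : R, [/\ 0 <= C, 0 < r &
  forall u (t rho : R), `|u| + `|t| * `|e| <= rho -> rho < r ->
    `|f (u + t *: e) - f u - t * (derive f 0 e + derive (g e) 0 u)
       - t ^+ 2 * (derive (g e) 0 e / 2)| <= C * `|t| * rho ^+ 2].
Proof.
have [C [r [C0 r0 HC]]] := taylor1_at (@smooth_derive _ _ f e sf).
exists C, r; split => // u t rho urho rhor.
pose q : R := derive (g e) 0 e / 2.
(* [psi] subtracts the quadratic polynomial along the line. Its derivative is the first-order Taylor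
   remainder of [derive f . e], of size [rho^2]; the mean value theorem supplies the factor
   [|t|]. *)
pose psi (s : R) : R := f (u + s *: e) - s * (derive f 0 e + derive (g e) 0 u) - s ^+ 2 * q.
pose dpsi (s : R) : R := derive f (u + s *: e) e - (derive f 0 e + derive (g e) 0 u) - 2 * s * q.
have Dpsi (s : R) : is_derive s (1 : R) psi (dpsi s).
  have H1 := is_derive_line u e s sf.
  rewrite /psi /dpsi; apply: is_derive_eq.
  rewrite !scaler0 !add0r /GRing.scale/=.
  by move: (derive f _ e) => x; ring.
have B s : `|s| <= `|t| -> `|dpsi s| <= C * rho ^+ 2.
  move=> st; have wr : `|u + s *: e| <= rho.
    apply: (le_trans (ler_normD _ _)); rewrite [X in _ + X]normrZ.
    by apply: le_trans urho; rewrite lerD2l ler_wpM2r.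
  have := HC _ _ wr rhor; congr (`|_| <= _).
  rewrite deriveD_dir ?deriveZ_dir; try exact: smooth_derive.
  have aux (x1 x2 x3 x4 : R) : x1 - x2 - (x3 + s * x4) = x1 - (x2 + x3) - 2 * s * (x4 / 2).
    by field.
  exact: aux.
have cpsi a b : {within `[a, b], continuous psi}.
  by apply: derivable_within_continuous => x _; have [] := Dpsi x.
have -> : f (u + t *: e) - f u - t * (derive f 0 e + derive (g e) 0 u) - t ^+ 2 * q =
  psi t - psi 0.
  by rewrite /psi scale0r addr0; ring.
have [t0|t0|->] := ltgtP t 0; last by rewrite subrr !normr0 mulr0 mul0r.
- have [c] := @MVT R psi dpsi t 0 t0 (fun x _ => Dpsi x) (cpsi _ _).
  rewrite in_itv/= => /andP[c1 c2] E.
  rewrite -normrN opprB E normrM sub0r normrN mulrAC ler_wpM2r//.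
  by apply: B; rewrite !ltr0_norm// lerN2 ltW.
- have [c] := @MVT R psi dpsi 0 t t0 (fun x _ => Dpsi x) (cpsi _ _).
  rewrite in_itv/= => /andP[c1 c2] E.
  rewrite E normrM subr0 mulrAC ler_wpM2r//.
  by apply: B; rewrite !gtr0_norm// ltW.
Qed.

Lemma continuous_line e (u : R -> V R n) (t : R -> R) (l : R) :
  {for l, continuous u} -> {for l, continuous t} ->
  {for l, continuous (fun l => f (u l + t l *: e))}.
Proof.
move=> cu ct.
have A : {for l, continuous (fun l => u l + t l *: e)}.
  apply: cvgD => //; exact: cvgZr_tmp.
apply: (@continuous_comp _ _ _ (fun l => u l + t l *: e) f) => //.
exact: smooth_continuous.
Qed.

(* The unknown is sought in the window [y = D s + z s^2], [|z| <= M]; the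
   constant [c] only fixes the direction of monotonicity. *)
Lemma solve_window (e : V R n) (u : R -> V R n) (s : R -> R) (D M c d : R) : 0 < M ->
  (forall l : R, - d < l < 0 -> 0 < s l) ->
  (forall l : R, - d < l < 0 -> {for l, continuous u}) ->
  (forall l : R, - d < l < 0 -> {for l, continuous s}) ->
  (forall l : R, - d < l < 0 -> forall z : R, - M <= z <= M ->
     0 < c * derive f (u l + (D * s l + z * s l ^+ 2) *: e) e) ->
  (forall l : R, - d < l < 0 ->
     c * f (u l + (D * s l + (- M) * s l ^+ 2) *: e) < 0 <
     c * f (u l + (D * s l + M * s l ^+ 2) *: e)) ->
  exists y : R -> R, forall l, - d < l < 0 ->
    [/\ {for l, continuous y}, `|y l - D * s l| <= M * s l ^+ 2 &
        f (u l + y l *: e) = 0].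
Proof.
move=> M0 s0 cu cs mono sgn.
pose H (l z : R) := c * f (u l + (D * s l + z * s l ^+ 2) *: e).
have csq (x : R) : {for x, continuous s} -> {for x, continuous (fun l => s l ^+ 2)}.
  move=> cx; apply: (@continuous_comp _ _ _ s (fun y : R => y ^+ 2)) => //.
  exact: exprn_continuous.
have cc a (x : R) : {for x, continuous s} -> {for x, continuous (fun l => D * s l + a * s l ^+ 2)}.
  move=> cx; apply: cvgD; first by apply: cvgM => //; exact: cvg_cst.
  by apply: cvgM; [exact: cvg_cst|exact: csq].
have [||||zeta Hz] := @continuous_zero R H d M M0.
- move=> l dl z _; rewrite /H; apply: cvgM; first exact: cvg_cst.
  exact: (@continuous_line e u (fun l => D * s l + z * s l ^+ 2) l (cu l dl) (cc z l (cs l dl))).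
- move=> l dl z; rewrite /H; apply: cvgM; first exact: cvg_cst.
  apply: (@continuous_line e (fun=> u l) (fun z => D * s l + z * s l ^+ 2) z).
    exact: cvg_cst.
  by apply: cvgD; [exact: cvg_cst|apply: cvgM; [exact: cvg_id|exact: cvg_cst]].
- move=> l dl z z' Mz zz' z'M; rewrite /H -subr_gt0 -mulrBr.
  (* The intermediate point is again in the window, with [z + th (z' - z)] for [z], so the sign of
     the derivative applies there. *)
  have [th /andP[th0 th1]] := line_MVT (u l + (D * s l + z * s l ^+ 2) *: e)
    (((z' - z) * s l ^+ 2) *: e) sf.
  rewrite -!addrA -!scalerDl.
  have -> : D * s l + z * s l ^+ 2 + (z' - z) * s l ^+ 2 = D * s l + z' * s l ^+ 2 by ring.
  move=> ->; rewrite deriveZ_dir// mulrCA mulr_gt0//.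
    by rewrite mulr_gt0// ?subr_gt0// exprn_gt0// s0.
  rewrite scalerA -scalerDl.
  have -> : D * s l + z * s l ^+ 2 + th * ((z' - z) * s l ^+ 2) =
     D * s l + (z + th * (z' - z)) * s l ^+ 2 by ring.
  apply: mono => //; nra.
- exact: sgn.
exists (fun l => D * s l + zeta l * s l ^+ 2) => l dl.
have [cz zM z0] := Hz l dl; split.
- apply: cvgD; first by apply: cvgM; [exact: cvg_cst|exact: cs].
  by apply: cvgM => //; exact/csq/cs.
- rewrite addrAC subrr add0r normrM [X in _ * X]ger0_norm ?sqr_ge0//.
  by rewrite ler_wpM2r// sqr_ge0.
- move: z0; rewrite /H => /eqP; rewrite mulf_eq0 => /orP[/eqP c0|/eqP//].
  by have := sgn l dl; rewrite c0 !mul0r ltxx.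
Qed.

End CellEquation.

(** * Numerical estimates in the window *)

Section RealEstimates.
Variable R : realType.
Implicit Types (A D E S k s t z M x : R).

(** The extra factor [S] makes the conclusion independent of the sign of [S]. *)
Lemma dominated_sign S k E : 0 < k -> `|E| < `|S| * k ->
  0 < S * (S * k + E) /\ S * (S * (- k) + E) < 0.
Proof.
move=> k0 H; have S0 : S != 0.
  by apply: contraTneq H => ->; rewrite normr0 mul0r -leNgt.
have : `|S * E| < S * S * k.
  by rewrite normrM -expr2 -real_normK ?num_real// expr2 -mulrA ltr_pM2l// normr_gt0.
rewrite ltr_norml => /andP[h1 h2]; split; lra.
Qed.

Lemma normD_le x y (x' y' : R) : `|x| <= x' -> `|y| <= y' -> `|x + y| <= x' + y'.
Proof. by move=> h h'; apply: (le_trans (ler_normD _ _)); exact: lerD. Qed.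

Lemma norm_window D M s z : 0 < s -> M * s <= 1 -> - M <= z <= M ->
  `|D * s + z * s ^+ 2| <= (`|D| + 1) * s.
Proof.
move=> s0 Ms zM; apply: (le_trans (ler_normD _ _)).
rewrite !normrM !(gtr0_norm s0) mulrDl lerD2l mul1r.
rewrite mulrA ler_piMl ?(ltW s0)//.
apply: le_trans Ms; rewrite ler_wpM2r ?(ltW s0)//.
by rewrite ler_norml.
Qed.

(** [fw] and [fu] stand for [f] at the window point and at the inputs, [du] for the linear part of
    [fu], [gu] for the linear part of the slope at the inputs. In [A t^2] the term [A D^2 s^2]
    cancels [du], [2 A D z s^3] is the main term, and [A z^2 s^4] is absorbed by [M^2 s <= 1]. *)
Lemma critical_value A D M s z (fw fu du gu x1 x2 x3 x4 : R) :
  0 < s -> M ^+ 2 * s <= 1 -> - M <= z <= M ->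
  let t := D * s + z * s ^+ 2 in
  `|fw - fu - t * gu - t ^+ 2 * A| <= x1 * s ^+ 3 ->
  `|fu - du| <= x2 * s ^+ 3 ->
  `|du + A * D ^+ 2 * s ^+ 2| <= x3 * s ^+ 3 ->
  `|t * gu| <= x4 * s ^+ 3 ->
  `|fw - (2 * A * D) * (z * s ^+ 3)| <= (x1 + x2 + x3 + x4 + `|A|) * s ^+ 3.
Proof.
move=> s0 Ms zM t h1 h2 h3 h4.
have -> : fw - (2 * A * D) * (z * s ^+ 3) =
  (fw - fu - t * gu - t ^+ 2 * A) + (fu - du) + (du + A * D ^+ 2 * s ^+ 2) + t * gu
   + A * (z ^+ 2 * s ^+ 4).
  by rewrite /t; ring.
have E5 : `|A * (z ^+ 2 * s ^+ 4)| <= `|A| * s ^+ 3; last first.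
  by apply: (le_trans (normD_le (normD_le (normD_le (normD_le h1 h2) h3) h4) E5)); lra.
have zs : 0 <= z ^+ 2 * s ^+ 4 by rewrite mulr_ge0 ?sqr_ge0// exprn_ge0// ltW.
rewrite normrM ler_wpM2l// (ger0_norm zs).
rewrite (_ : z ^+ 2 * s ^+ 4 = z ^+ 2 * s * s ^+ 3); last by ring.
rewrite ler_piMl ?exprn_ge0 ?(ltW s0)//; apply: le_trans Ms.
have zM' : `|z| <= M by rewrite ler_norml.
rewrite ler_wpM2r ?(ltW s0)// -[leLHS]real_normK ?num_real//.
by rewrite lerXn2r ?nnegrE// (le_trans (normr_ge0 z)).
Qed.

(** The error constant may contain [M]: the slope only needs a definite sign for small [s], and [s]
    is restricted after [M] is fixed. *)
Lemma critical_slope A D M s z (gw gu x1 x2 : R) :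
  0 < s -> - M <= z <= M ->
  let t := D * s + z * s ^+ 2 in
  `|gw - (gu + t * (2 * A))| <= x1 * s ^+ 2 ->
  `|gu| <= x2 * s ^+ 2 ->
  `|gw - (2 * A * D) * s| <= (x1 + x2 + 2 * `|A| * M) * s ^+ 2.
Proof.
move=> s0 zM t h1 h2.
have -> : gw - (2 * A * D) * s = (gw - (gu + t * (2 * A))) + gu + 2 * A * z * s ^+ 2.
  by rewrite /t; ring.
have E3 : `|2 * A * z * s ^+ 2| <= 2 * `|A| * M * s ^+ 2; last first.
  by apply: (le_trans (normD_le (normD_le h1 h2) E3)); lra.
rewrite 3!normrM (@ger0_norm _ 2)// [X in _ * X <= _]ger0_norm ?sqr_ge0//.
rewrite ler_wpM2r ?sqr_ge0// ler_wpM2l ?mulr_ge0//.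
by rewrite ler_norml.
Qed.

(** Divided by [t], the value is [gu + A t] up to [O(s^2)]; as [gu] is [- A D s] to leading order,
    [A z s^2] remains. [M s < |D|] keeps [t] nonzero, with the sign of [D]. *)
Lemma transcritical_value A D M s z (fw gu x1 x2 : R) :
  0 < s -> M * s < `|D| -> - M <= z <= M ->
  let t := D * s + z * s ^+ 2 in
  `|fw - t * gu - t ^+ 2 * A| <= x1 * `|t| * s ^+ 2 ->
  `|gu + A * D * s| <= x2 * s ^+ 2 ->
  exists E, [/\ 0 < D * t, fw = t * (A * (z * s ^+ 2) + E) & `|E| <= (x1 + x2) * s ^+ 2].
Proof.
move=> s0 Ms zM t h1 h2.
have zM' : `|z| <= M by rewrite ler_norml.
have [Dt _] : 0 < D * (D * s + z * s ^+ 2) /\ D * (D * - s + z * s ^+ 2) < 0.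
  apply: dominated_sign => //; rewrite normrM [X in _ * X < _]ger0_norm ?sqr_ge0//.
  rewrite expr2 mulrA ltr_pM2r//; apply: le_lt_trans Ms.
  by rewrite ler_wpM2r// ltW.
rewrite -/t in Dt.
have t0 : t != 0 by apply: contraTneq Dt => ->; rewrite mulr0 ltxx.
exists ((fw - t * gu - t ^+ 2 * A) / t + (gu + A * D * s)); split => //.
  by rewrite [in RHS]/t -/t; rewrite /t in t0 *; field.
rewrite [leRHS]mulrDl; apply: normD_le => //.
rewrite normf_div ler_pdivrMr ?normr_gt0//.
by rewrite [leRHS]mulrAC.
Qed.

(** The slope is [gu + 2 A t], where [gu] cancels half of the leading term [2 A D s]. *)
Lemma transcritical_slope A D M s z (gw gu x1 x2 : R) :
  0 < s -> - M <= z <= M ->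
  let t := D * s + z * s ^+ 2 in
  `|gw - (gu + t * (2 * A))| <= x1 * s ^+ 2 ->
  `|gu + A * D * s| <= x2 * s ^+ 2 ->
  `|gw - (A * D) * s| <= (x1 + x2 + 2 * `|A| * M) * s ^+ 2.
Proof.
move=> s0 zM t h1 h2.
have -> : gw - (A * D) * s = (gw - (gu + t * (2 * A))) + (gu + A * D * s) + 2 * A * z * s ^+ 2.
  by rewrite /t; ring.
have E3 : `|2 * A * z * s ^+ 2| <= 2 * `|A| * M * s ^+ 2; last first.
  by apply: (le_trans (normD_le (normD_le h1 h2) E3)); lra.
rewrite 3!normrM (@ger0_norm _ 2)// [X in _ * X <= _]ger0_norm ?sqr_ge0//.
rewrite ler_wpM2r ?sqr_ge0// ler_wpM2l ?mulr_ge0//.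
by rewrite ler_norml.
Qed.

Lemma regular_value S D s z (fw du x1 x2 : R) :
  let t := D * s + z * s ^+ 2 in
  `|fw - (du + t * S)| <= x1 * s ^+ 2 ->
  `|du + D * S * s| <= x2 * s ^+ 2 ->
  `|fw - S * (z * s ^+ 2)| <= (x1 + x2) * s ^+ 2.
Proof.
move=> t h1 h2.
have -> : fw - S * (z * s ^+ 2) = (fw - (du + t * S)) + (du + D * S * s).
  by rewrite /t; ring.
by rewrite [leRHS]mulrDl; exact: normD_le.
Qed.

Lemma dominated_pos S k x : 0 < k -> `|x - S * k| < `|S| * k -> 0 < S * x.
Proof.
move=> k0 /(dominated_sign k0)[+ _].
by rewrite (_ : S * k + (x - S * k) = x) //; ring.
Qed.

Lemma dominated_ends S k (fm fp x : R) : 0 < k -> x < `|S| * k ->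
  `|fm - S * (- k)| <= x -> `|fp - S * k| <= x -> S * fm < 0 < S * fp.
Proof.
move=> k0 xk hm hp; apply/andP; split.
  have [_] := dominated_sign k0 (le_lt_trans hm xk).
  by rewrite (_ : S * - k + (fm - S * - k) = fm) //; ring.
have [+ _] := dominated_sign k0 (le_lt_trans hp xk).
by rewrite (_ : S * k + (fp - S * k) = fp) //; ring.
Qed.

(** Each branch lemma below lists its smallness conditions [x s < y] as pairs and gets a single
    threshold. *)
Lemma exists_scale (ps : seq (R * R)) : all (fun p => (0 <= p.1) && (0 < p.2)) ps ->
  exists2 r : R, 0 < r & forall s, 0 < s -> s < r -> all (fun p => p.1 * s < p.2) ps.
Proof.
elim: ps => [|[x y] ps IH] /=; first by exists 1.
move=> /andP[/andP[x0 y0] /IH[r r0 Hr]].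
have x1 : 0 < x + 1 by rewrite ltr_wpDl.
exists (Num.min r (y / (x + 1))); first by rewrite lt_min r0 divr_gt0.
move=> s s0; rewrite lt_min => /andP[sr]; rewrite ltr_pdivlMr// => h.
rewrite Hr// andbT; apply: le_lt_trans h.
by rewrite mulrDr mulr1 mulrC lerDl ltW.
Qed.

End RealEstimates.

(** * Branches of a single cell: regular, fold, transcritical *)

Section CellBranch.
Variables (R : realType) (n : nat) (f : V R n -> R).
Hypotheses (sf : smooth f) (f0 : f 0 = 0).
Variables (e : V R n) (u : R -> V R n) (k : nat) (d : R).
Hypotheses (d0 : 0 < d) (cu : forall l : R, - d < l < 0 -> {for l, continuous u}).

Local Notation s := (@scale R k).

Let s0 (l : R) : - d < l < 0 -> 0 < s l.
Proof. by move=> /andP[_]; exact: scale_gt0. Qed.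

Let cs (l : R) : - d < l < 0 -> {for l, continuous s}.
Proof. by move=> /andP[_]; exact: scale_continuous. Qed.

Local Notation g := (fun y => derive f y e).

Definition cell_branch (D : R) := exists d' M : R, exists y : R -> R,
  [/\ 0 < d', d' <= d & forall l : R, - d' < l < 0 ->
    [/\ {for l, continuous y}, `|y l - D * s l| <= M * s l ^+ 2 &
        f (u l + y l *: e) = 0]].

Lemma solve_small (D M c r : R) : 0 < M -> 0 < r ->
  (forall l : R, - d < l < 0 -> s l < r ->
     (forall z : R, - M <= z <= M ->
       0 < c * derive f (u l + (D * s l + z * s l ^+ 2) *: e) e) /\
     (c * f (u l + (D * s l + (- M) * s l ^+ 2) *: e) < 0 <
     c * f (u l + (D * s l + M * s l ^+ 2) *: e))) ->
  cell_branch D.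
Proof.
move=> M0 r0 H; have [d1 d10 Hd1] := scale_small k r0.
pose d' := Num.min d d1.
have d'0 : 0 < d' by rewrite lt_min d0.
have d'd (l : R) : - d' < l < 0 -> - d < l < 0 /\ s l < r.
  move=> /andP[h l0].
  have h1 : - d < l by apply: le_lt_trans h; rewrite lerN2 ge_min lexx.
  have h2 : - d1 < l by apply: le_lt_trans h; rewrite lerN2 ge_min lexx orbT.
  by split; [rewrite h1|apply: Hd1; rewrite h2].
have [|||||y Hy] := @solve_window R n f sf e u s D M c d' M0.
- by move=> l /d'd[dl _]; exact: s0.
- by move=> l /d'd[dl _]; exact: cu.
- by move=> l /d'd[dl _]; exact: cs.
- by move=> l /d'd[dl sr]; have [h _] := H l dl sr.
- by move=> l /d'd[dl sr]; have [_ h] := H l dl sr.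
exists d', M, y; split => //.
by rewrite ge_min lexx.
Qed.

Lemma norm_line (D kappa M : R) (l z : R) : - d < l < 0 -> `|u l| <= kappa * s l ->
  M * s l <= 1 -> - M <= z <= M ->
  `|u l| + `|D * s l + z * s l ^+ 2| * `|e| <= (kappa + (`|D| + 1) * `|e|) * s l.
Proof.
move=> dl ul Ms zM; rewrite mulrDl; apply: lerD => //.
by rewrite mulrAC ler_wpM2r//; apply: norm_window Ms zM; exact: s0.
Qed.

Lemma norm_lineD (t : R) v : `|v + t *: e| <= `|v| + `|t| * `|e|.
Proof. by apply: (le_trans (ler_normD _ _)); rewrite [X in _ + X]normrZ. Qed.

(** The equation is linear to leading order; the hypothesis says that [D] solves its leading part up
    to [O(s^2)], the precision of the window. *)
Lemma branch_regular (D kappa c1 : R) : derive f 0 e != 0 -> 0 <= kappa -> 0 <= c1 ->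
  (forall l : R, - d < l < 0 -> `|u l| <= kappa * s l /\
     `|derive f 0 (u l) + D * derive f 0 e * s l| <= c1 * s l ^+ 2) ->
  cell_branch D.
Proof.
have [S ES] : exists S : R, derive f 0 e = S by exists (derive f 0 e).
rewrite ES => S0 k0 c10 Hu.
have [C [r1 [C0 r10 HC]]] := taylor1_at sf.
have [L L0 HL] := smooth_lipschitz0 (@smooth_derive _ _ f e sf).
have [r2 r20 Hr2] := near0_and HL HL.
pose K := kappa + (`|D| + 1) * `|e|.
have K0 : 0 <= K by rewrite addr_ge0// mulr_ge0// addr_ge0.
pose c2 := C * K ^+ 2 + c1.
have c20 : 0 <= c2 by rewrite addr_ge0// mulr_ge0// sqr_ge0.
have nS : 0 < `|S| by rewrite normr_gt0.
(* [c2] is the error constant of [val] below and does not involve [M]; [|S| M = c2 + 1] makes the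
   main term win at both ends of the window. *)
pose M := (c2 + 1) / `|S|.
have M0 : 0 < M by rewrite divr_gt0// ltr_wpDl.
have SM : `|S| * M = c2 + 1 by rewrite /M mulrC divfK// normr_eq0.
clearbody M.
(* In turn: [norm_window] applies, the Taylor and Lipschitz bounds apply, and the slope keeps the
   sign of [S]. *)
have [|r r0 Hr] := @exists_scale R [:: (M, 1); (K, r1); (K, r2); (L * K, `|S|)].
  by rewrite /= K0 r10 r20 nS ltr01 (ltW M0) mulr_ge0.
apply: (@solve_small D M S r M0 r0) => l dl slr.
have sl := s0 dl.
have /= := Hr _ sl slr; rewrite andbT => /and4P[/ltW Ms Kr1 Kr2 LK].
have [ul dul] := Hu l dl.
have nw (z : R) : - M <= z <= M -> `|u l + (D * s l + z * s l ^+ 2) *: e| <= K * s l.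
  by move=> zM; apply: (le_trans (norm_lineD _ _)); exact: norm_line dl ul Ms zM.
split.
  move=> z zM; apply: (@dominated_pos _ _ 1) => //; rewrite !mulr1.
  have [h _] := Hr2 _ (le_lt_trans (nw z zM) Kr2).
  move: h; rewrite /= ES => h; apply: le_lt_trans LK; apply: (le_trans h).
  by rewrite -mulrA ler_wpM2l// nw.
have val (z : R) : - M <= z <= M ->
    `|f (u l + (D * s l + z * s l ^+ 2) *: e) - S * (z * s l ^+ 2)| <= c2 * s l ^+ 2.
  move=> zM; apply: (@regular_value _ S D (s l) z _ (derive f 0 (u l))) => //.
  have := HC _ _ (nw z zM) Kr1.
  by rewrite f0 subr0 deriveD_dir// deriveZ_dir// ES exprMn [C * (_ * _)]mulrA.
apply: (@dominated_ends _ _ (M * s l ^+ 2) _ _ (c2 * s l ^+ 2)).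
- by rewrite mulr_gt0// exprn_gt0.
- by rewrite [ltRHS]mulrA SM ltr_pM2r ?exprn_gt0// ltrDl.
- by rewrite -[- (M * _)]mulNr; apply: val; rewrite lexx; lra.
- by apply: val; rewrite lexx andbT; lra.
Qed.

Lemma slope_line (A : R) : derive f 0 e = 0 -> A = derive g 0 e / 2 ->
  exists C r : R, [/\ 0 <= C, 0 < r & forall (v : V R n) (t rho : R), `|v| + `|t| * `|e| <= rho -> rho < r ->
    `|derive f (v + t *: e) e - (derive g 0 v + t * (2 * A))| <= C * rho ^+ 2].
Proof.
move=> E0 EA.
have [C [r [C0 r0 HC]]] := taylor1_at (@smooth_derive _ _ f e sf).
exists C, r; split => // v t rho h1 h2.
have := HC _ _ (le_trans (norm_lineD _ _) h1) h2.
have -> : 2 * A = derive g 0 e by rewrite EA mulrC divfK.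
have sg := @smooth_derive _ _ f e sf.
by rewrite E0 subr0 (deriveD_dir _ _ _ sg) (deriveZ_dir _ _ _ sg).
Qed.

(** With inputs of size [s^2] the leading equation is [A y^2 = A D^2 s^2]. Its slope at [y = D s] is
    [2 A D s], so [f] at the ends of the window is of order [s^3]. *)
Lemma branch_fold (A D kappa c1 : R) : derive f 0 e = 0 -> A = derive g 0 e / 2 ->
  A != 0 -> D != 0 -> 0 <= kappa -> 0 <= c1 ->
  (forall l : R, - d < l < 0 -> `|u l| <= kappa * s l ^+ 2 /\
     `|derive f 0 (u l) + A * D ^+ 2 * s l ^+ 2| <= c1 * s l ^+ 3) ->
  cell_branch D.
Proof.
move=> E0 EA A0 D0 k0 c10 Hu.
have [C [r1 [C0 r10 HC]]] := taylor1_at sf.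
have [C' [r2 [C'0 r20 HC']]] := taylor_line sf e.
have [Cg [r3 [Cg0 r30 HCg]]] := slope_line E0 EA.
have [L L0 HL] := derive_lipschitz0 (@smooth_derive _ _ f e sf).
pose K := kappa + (`|D| + 1) * `|e|.
have D10 : 0 <= `|D| + 1 by rewrite addr_ge0.
have K0 : 0 <= K by rewrite addr_ge0// mulr_ge0.
have kK : kappa <= K by rewrite lerDl mulr_ge0.
pose c2 := C' * (`|D| + 1) * K ^+ 2 + C * kappa ^+ 2 + c1 + (`|D| + 1) * (L * kappa) + `|A|.
have c20 : 0 <= c2.
  by rewrite !addr_ge0// ?mulr_ge0// sqr_ge0.
pose S := 2 * A * D.
have nS : 0 < `|S| by rewrite normr_gt0 !mulf_neq0// pnatr_eq0.
pose M := (c2 + 1) / `|S|.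
have M0 : 0 < M by rewrite divr_gt0// ltr_wpDl.
have SM : `|S| * M = c2 + 1 by rewrite /M mulrC divfK// gt_eqF.
clearbody M.
pose c3 := Cg * K ^+ 2 + L * kappa + 2 * `|A| * M.
have c30 : 0 <= c3.
  have A20 : 0 <= 2 * `|A| by rewrite mulr_ge0.
  by rewrite !addr_ge0// ?mulr_ge0// ?sqr_ge0 ?(ltW M0).
have [|r r0 Hr] := @exists_scale R
   [:: (1, 1); (M, 1); (M ^+ 2, 1); (K, r1); (K, r2); (K, r3); (c3, `|S|)].
  by rewrite /= K0 r10 r20 r30 nS ltr01 ler01 (ltW M0) c30 sqr_ge0.
apply: (@solve_small D M S r M0 r0) => l dl slr.
have sl := s0 dl.
have sqE (c : R) : c * (K * s l) ^+ 2 = c * K ^+ 2 * s l ^+ 2 by ring.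
have /= := Hr _ sl slr; rewrite andbT mul1r.
move=> /andP[/ltW s1 /and5P[/ltW Ms /ltW MMs Kr1 Kr2 /andP[Kr3 c3S]]].
have [ul dul] := Hu l dl.
have ss : s l ^+ 2 <= s l by rewrite expr2 ler_piMl// ltW.
have ul' : `|u l| <= kappa * s l by apply: (le_trans ul); rewrite ler_wpM2l.
have gul : `|derive g 0 (u l)| <= L * kappa * s l ^+ 2.
  by apply: (le_trans (HL _)); rewrite -mulrA ler_wpM2l.
split.
  move=> z zM; apply: (@dominated_pos _ _ (s l)) => //.
  have h := HCg _ _ _ (norm_line D dl ul' Ms zM) Kr3.
  rewrite -/K sqE in h.
  apply: (le_lt_trans (critical_slope sl zM h gul)).
  by rewrite -/c3 [ltLHS]mulrA ltr_pM2r.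
have val (z : R) : - M <= z <= M ->
    `|f (u l + (D * s l + z * s l ^+ 2) *: e) - S * (z * s l ^+ 3)| <= c2 * s l ^+ 3.
  move=> zM; have tle := norm_window D sl Ms zM.
  apply: (@critical_value _ A D M (s l) z _ (f (u l)) (derive f 0 (u l)) (derive g 0 (u l))) => //.
  - have := HC' _ _ _ (norm_line D dl ul' Ms zM) Kr2.
    rewrite E0 add0r -EA => h; apply: (le_trans h); rewrite exprMn.
    rewrite (_ : C' * (`|D| + 1) * K ^+ 2 * s l ^+ 3 =
       C' * ((`|D| + 1) * s l) * (K ^+ 2 * s l ^+ 2)); last by ring.
    apply: ler_wpM2r; first by apply: mulr_ge0; exact: sqr_ge0.
    exact: ler_wpM2l.
  - have kr : kappa * s l ^+ 2 < r1.
      apply: le_lt_trans Kr1; apply: (le_trans (ler_wpM2l k0 ss)).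
      by rewrite ler_wpM2r// ltW.
    have := HC _ _ ul kr; rewrite f0 subr0 => h; apply: (le_trans h).
    rewrite (_ : C * (kappa * s l ^+ 2) ^+ 2 = C * kappa ^+ 2 * (s l * s l ^+ 3)); last by ring.
    apply: ler_wpM2l; first by apply: mulr_ge0 => //; exact: sqr_ge0.
    by rewrite ler_piMl// exprn_ge0// ltW.
  - rewrite normrM (_ : (`|D| + 1) * (L * kappa) * s l ^+ 3 =
      ((`|D| + 1) * s l) * (L * kappa * s l ^+ 2)); last by ring.
    exact: ler_pM.
apply: (@dominated_ends _ _ (M * s l ^+ 3) _ _ (c2 * s l ^+ 3)).
- by rewrite mulr_gt0// exprn_gt0.
- by rewrite [ltRHS]mulrA SM ltr_pM2r ?exprn_gt0// ltrDl.
- by rewrite -[- (M * _)]mulNr; apply: val; rewrite lexx; lra.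
- by apply: val; rewrite lexx andbT; lra.
Qed.

(** Used with [u] the synchronous state and [D] the difference [D p - ell / K], so that the unknown
    is the distance from [X l]. Exactness of [f (u l) = 0] makes the remainder divisible by [t]. *)
Lemma branch_transcritical (A D kappa c1 : R) : derive f 0 e = 0 -> A = derive g 0 e / 2 ->
  A != 0 -> D != 0 -> 0 <= kappa -> 0 <= c1 ->
  (forall l : R, - d < l < 0 -> [/\ f (u l) = 0, `|u l| <= kappa * s l &
     `|derive g 0 (u l) + A * D * s l| <= c1 * s l ^+ 2]) ->
  cell_branch D.
Proof.
move=> E0 EA A0 D0 k0 c10 Hu.
have [C' [r2 [C'0 r20 HC']]] := taylor_line sf e.
have [Cg [r3 [Cg0 r30 HCg]]] := slope_line E0 EA.
pose K := kappa + (`|D| + 1) * `|e|.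
have D10 : 0 <= `|D| + 1 by rewrite addr_ge0.
have K0 : 0 <= K by rewrite addr_ge0// mulr_ge0.
pose c2 := C' * K ^+ 2 + c1.
have c20 : 0 <= c2 by rewrite !addr_ge0// ?mulr_ge0// sqr_ge0.
have nA : 0 < `|A| by rewrite normr_gt0.
have nD : 0 < `|D| by rewrite normr_gt0.
pose M := (c2 + 1) / `|A|.
have M0 : 0 < M by rewrite divr_gt0// ltr_wpDl.
have AM : `|A| * M = c2 + 1 by rewrite /M mulrC divfK// gt_eqF.
clearbody M.
pose c3 := Cg * K ^+ 2 + c1 + 2 * `|A| * M.
have c30 : 0 <= c3.
  have A20 : 0 <= 2 * `|A| by rewrite mulr_ge0.
  by rewrite !addr_ge0// ?mulr_ge0// ?sqr_ge0 ?(ltW M0).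
have [|r r0 Hr] := @exists_scale R
   [:: (M, 1); (M, `|D|); (K, r2); (K, r3); (c3, `|A * D|)].
  by rewrite /= K0 r20 r30 nD ltr01 (ltW M0) c30 normr_gt0 mulf_neq0.
(* [f] is [t] times a reduced equation of slope [A], and [t] has the sign of [D]; hence the
   direction [A * D]. *)
apply: (@solve_small D M (A * D) r M0 r0) => l dl slr.
have sl := s0 dl.
have sqE (c : R) : c * (K * s l) ^+ 2 = c * K ^+ 2 * s l ^+ 2 by ring.
have /= := Hr _ sl slr; rewrite andbT.
move=> /and5P[/ltW Ms MD Kr2 Kr3 c3S].
have [ful ul gul] := Hu l dl.
split.
  move=> z zM; apply: (@dominated_pos _ _ (s l)) => //.
  have h := HCg _ _ _ (norm_line D dl ul Ms zM) Kr3.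
  rewrite -/K sqE in h.
  apply: (le_lt_trans (transcritical_slope sl zM h gul)).
  by rewrite -/c3 [ltLHS]mulrA ltr_pM2r.
have val (z : R) : - M <= z <= M -> exists E : R,
    [/\ 0 < D * (D * s l + z * s l ^+ 2), f (u l + (D * s l + z * s l ^+ 2) *: e) =
        (D * s l + z * s l ^+ 2) * (A * (z * s l ^+ 2) + E) & `|E| <= c2 * s l ^+ 2].
  move=> zM.
  apply: (@transcritical_value _ A D M (s l) z _ (derive g 0 (u l))) => //.
  have := HC' _ _ _ (norm_line D dl ul Ms zM) Kr2.
  rewrite ful subr0 E0 add0r -EA => h; apply: (le_trans h).
  by rewrite le_eqVlt -/K; apply/orP; left; apply/eqP; ring.
have [|Em [tm -> hm]] := val (- M); first by rewrite lexx; lra.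
have [|Ep [tp -> hp]] := val M; first by rewrite lexx andbT; lra.
have Ms2 : 0 < M * s l ^+ 2 by rewrite mulr_gt0// exprn_gt0.
have cM : c2 * s l ^+ 2 < `|A| * (M * s l ^+ 2).
  by rewrite [ltRHS]mulrA AM ltr_pM2r ?exprn_gt0// ltrDl.
have [_ sm] := dominated_sign Ms2 (le_lt_trans hm cM).
have [sp _] := dominated_sign Ms2 (le_lt_trans hp cM).
have aux (t x : R) : A * D * (t * x) = (D * t) * (A * x) by ring.
rewrite !aux pmulr_rgt0// pmulr_rlt0//.
by rewrite mulNr sm sp.
Qed.

End CellBranch.

(** * Inputs and self-loops in the steady-state equation *)

Section NetworkBranch.
Variables (C : finType) (n : nat) (sigma : 'I_n.+1 -> C -> C) (R : realType).
Variables (f : V R n -> R).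
Hypothesis sf : smooth f.

Local Notation a := (coef_a f).
Local Notation ell := (coef_ell f).
Local Notation SL p := (\sum_(i | sigma i p == p) a i).
Local Notation A p := (\sum_(i | sigma i p == p) \sum_(j | sigma j p == p) coef_f2 f i j).
Local Notation Mix p := (\sum_(i | sigma i p == p) \sum_(j | sigma j p != p) coef_f2 f i j).
Local Notation Fl p := (\sum_(i | sigma i p == p) coef_flam f i).

Definition self_dir p : V R n := \sum_(i | sigma i p == p) ex R i.

Definition input_vec (x : C -> R) (l : R) p : V R n :=
  \sum_(i | sigma i p != p) x (sigma i p) *: ex R i + l *: elam R n.

Lemma gamma_split x l p :
  gamma sigma f x l p = f (input_vec x l p + x p *: self_dir p).
Proof.
rewrite /gamma row_coord (bigID (fun i => sigma i p == p)) /= /input_vec.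
rewrite [X in X + _]addrC addrAC; congr (f (_ + _)).
by rewrite /self_dir scaler_sumr; apply: eq_bigr => i /eqP ->.
Qed.

Lemma derive_sum_dir1 (P : pred 'I_n.+1) f0 y : smooth f0 ->
  derive f0 y (\sum_(i | P i) ex R i) = \sum_(i | P i) derive f0 y (ex R i).
Proof.
move=> s0; rewrite (eq_bigr (fun i => 1 *: ex R i)); last by move=> i _; rewrite scale1r.
by rewrite derive_sum_dir//; apply: eq_bigr => i _; rewrite mul1r.
Qed.

Lemma derive_self p : derive f 0 (self_dir p) = SL p.
Proof. exact: derive_sum_dir1. Qed.

Lemma derive_input x l p : derive f 0 (input_vec x l p) =
  \sum_(i | sigma i p != p) x (sigma i p) * a i + l * ell.
Proof. by rewrite /input_vec deriveD_dir// deriveZ_dir// derive_sum_dir. Qed.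

Local Notation g p := (fun y => derive f y (self_dir p)).

(** The sum over the self-loops sits in the inner derivative; [schwarz] moves it to the outer one,
    where additivity applies. *)
Lemma derive2_ex p i : derive (g p) 0 (ex R i) = 2 * \sum_(j | sigma j p == p) coef_f2 f j i.
Proof.
rewrite schwarz// derive_sum_dir1; last exact: smooth_derive.
rewrite mulr_sumr; apply: eq_bigr => j _.
by rewrite /coef_f2 mulrA divff ?mul1r// pnatr_eq0.
Qed.

Lemma derive2_elam p : derive (g p) 0 (elam R n) = Fl p.
Proof.
rewrite schwarz//; have s1 := smooth_derive (elam R n) sf.
exact: (derive_sum_dir1 _ _ s1).
Qed.

Lemma derive2_self p : A p = derive (g p) 0 (self_dir p) / 2.
Proof.
rewrite derive_sum_dir1; last exact: smooth_derive.
rewrite (eq_bigr _ (fun i _ => derive2_ex p i)) -mulr_sumr mulrAC divff ?pnatr_eq0// mul1r.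
by move: (coef_f2 f) => F; exact: exchange_big.
Qed.

Definition sync_vec (X l : R) : V R n := X *: (\sum_i ex R i) + l *: elam R n.

(** Source of the formula for [D p] at a critical cell with [mu p = 0]: the linear part of the slope
    at the synchronous state. *)
Lemma derive2_sync p X l :
  derive (g p) 0 (sync_vec X l) = X * (2 * A p + 2 * Mix p) + l * Fl p.
Proof.
have sg := smooth_derive (self_dir p) sf.
rewrite deriveD_dir// !deriveZ_dir// derive2_elam derive_sum_dir1//; congr (X * _ + _).
rewrite (eq_bigr _ (fun i _ => derive2_ex p i)) -mulr_sumr -mulrDr; congr (2 * _).
move: (coef_f2 f) => F; rewrite exchange_big -big_split /=; apply: eq_bigr => j _.
by rewrite (bigID (fun i => sigma i p == p)).
Qed.

Lemma sync_vecE X l : sync_vec X l = (\row_(i < n.+1) X, l).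
Proof. by rewrite row_coord /sync_vec scaler_sumr. Qed.

Lemma sync_split X l p (x : C -> R) : (forall i, sigma i p != p -> x (sigma i p) = X) ->
  sync_vec X l = input_vec x l p + X *: self_dir p.
Proof.
move=> H; rewrite /sync_vec /input_vec /self_dir addrAC; congr (_ + _).
rewrite (bigID (fun i => sigma i p == p)) /= scalerDr addrC; congr (_ + _).
by rewrite scaler_sumr; apply: eq_bigr => i /H->.
Qed.

Lemma continuous_sum_scale (I : Type) (r : seq I) (P : pred I) (c : I -> R -> R)
    (v : I -> V R n) (l : R) :
  (forall i, P i -> {for l, continuous (c i)}) ->
  {for l, continuous (fun t => \sum_(i <- r | P i) c i t *: v i)}.
Proof.
move=> H; elim: r => [|i r IH].
  have -> : (fun t => \sum_(i <- [::] | P i) c i t *: v i) = fun=> 0.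
    by apply/funext => t; rewrite big_nil.
  exact: cvg_cst.
case Pi : (P i); last first.
  have -> // : (fun t => \sum_(i <- i :: r | P i) c i t *: v i) =
          (fun t => \sum_(i <- r | P i) c i t *: v i).
  by apply/funext => t; rewrite big_cons Pi.
have -> : (fun t => \sum_(i <- i :: r | P i) c i t *: v i) =
          (fun t => c i t *: v i + \sum_(i <- r | P i) c i t *: v i).
  by apply/funext => t; rewrite big_cons Pi.
by apply: cvgD => //; apply: cvgZr_tmp; exact: H.
Qed.

Lemma continuous_scale_id (v : V R n) (l : R) : {for l, continuous (fun t : R => t *: v)}.
Proof. by apply: cvgZr_tmp; exact: cvg_id. Qed.

Lemma continuous_input (x : R -> C -> R) p (l : R) :
  (forall i, sigma i p != p -> {for l, continuous (x^~ (sigma i p))}) ->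
  {for l, continuous (fun t => input_vec (x t) t p)}.
Proof.
move=> H; apply: cvgD; last exact: continuous_scale_id.
exact: (@continuous_sum_scale _ _ _ (fun i t => x t (sigma i p))).
Qed.

Lemma continuous_sync (X : R -> R) (l : R) : {for l, continuous X} ->
  {for l, continuous (fun t => sync_vec (X t) t)}.
Proof.
by move=> H; apply: cvgD; [exact: cvgZr_tmp|exact: continuous_scale_id].
Qed.

End NetworkBranch.

(** * Extending the branch cell by cell *)

Section BranchInduction.
Variables (C : finType) (n : nat) (sigma : 'I_n.+1 -> C -> C) (R : realType).
Variables (f : V R n -> R) (B : {set C}) (D : C -> R).

Local Notation a := (coef_a f).
Local Notation ell := (coef_ell f).
Local Notation K := (\sum_i a i).
Local Notation crit := (critical sigma a).
Local Notation m := (mu sigma a B).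
Local Notation SL p := (\sum_(i | sigma i p == p) a i).
Local Notation Sext p := (\sum_(i | sigma i p != p) a i * D (sigma i p)).
Local Notation SQ p := (\sum_(i | inQ sigma a B p (sigma i p)) a i * D (sigma i p)).
Local Notation A p := (\sum_(i | sigma i p == p) \sum_(j | sigma j p == p) coef_f2 f i j).
Local Notation Mix p := (\sum_(i | sigma i p == p) \sum_(j | sigma j p != p) coef_f2 f i j).
Local Notation Fl p := (\sum_(i | sigma i p == p) coef_flam f i).

Hypotheses (ff : feedforward sigma) (sf : smooth f) (f0 : f 0 = 0)
  (critNmax : forall p, crit p -> ~~ maximal sigma p)
  (rootB : root_subnetwork sigma a B)
  (D_neq0 : forall p, D p != 0)
  (D_root : forall p, p \in B -> D p = ell / K)
  (D_regular0 : forall p, p \notin B -> ~~ crit p -> m p = 0%N ->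
     D p = - (Sext p - ell) / SL p)
  (D_regular : forall p, p \notin B -> ~~ crit p -> (0 < m p)%N -> D p = - SQ p / SL p)
  (D_critical0 : forall p, p \notin B -> crit p -> m p = 0%N ->
     A p != 0 /\ D p = - (ell / K) * (1 + 2 * (Mix p / A p)) + Fl p / A p)
  (D_critical1 : forall p, crit p -> m p = 1%N ->
     (Sext p - ell) / A p < 0 /\
     (D p = Num.sqrt (- (Sext p - ell) / A p) \/ D p = - Num.sqrt (- (Sext p - ell) / A p)))
  (D_critical : forall p, crit p -> (1 < m p)%N ->
     SQ p / A p < 0 /\
     (D p = Num.sqrt (- SQ p / A p) \/ D p = - Num.sqrt (- SQ p / A p))).

(** At a maximal cell every arrow is a self-loop, so [K] is the sum that decides its criticality. *)
Lemma K_neq0 : K != 0.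
Proof.
have [[[b _] _] _ _ _] := rootB.
have [p maxp] := exists_maximal ff b.
have := contraL (@critNmax p) maxp; rewrite /critical.
by rewrite (eq_bigl xpredT)// => i; have /forallP/(_ i) := maxp.
Qed.

(* Leading coefficient of the linear part of the inputs of [p] at scale [k]. *)
Definition drive p (k : nat) : R :=
  \sum_(i | sigma i p != p) a i * (if m (sigma i p) == k then D (sigma i p) else 0)
    - (if k == 0%N then ell else 0).

(** If the difference is [0], all inputs have [mu = 0] and contribute together with [ell]; otherwise
    the inputs at the top scale are those in [Q_p]. *)
Lemma driveE p : p \notin B -> drive p (m p - crit p)%N =
  if (m p - crit p == 0)%N then Sext p - ell else SQ p.
Proof.
move=> pB; rewrite /drive; case: eqP => [k0|/eqP]; last rewrite -lt0n => k0.
  congr (_ - _); apply: eq_bigr => i ip.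
  by have := mu_input_le ff rootB pB ip; rewrite k0 leqn0 => ->.
rewrite subr0 [RHS](eq_bigl (fun i => (sigma i p != p) && (m (sigma i p) == m p - crit p)%N)).
  by rewrite [RHS]big_mkcondr; apply: eq_bigr => i _; case: ifP => // _; rewrite mulr0.
by move=> i; exact: (inQE ff rootB).
Qed.

(** [d <= 1] keeps all scales at most [1]; synchrony of [B] is recorded because the transcritical
    step needs the exact synchronous state. *)
Definition partial_branch (S : {set C}) (d M : R) (x : R -> C -> R) : Prop :=
  [/\ 0 < d, d <= 1, 0 <= M & forall l : R, - d < l < 0 ->
    [/\ forall p, p \in S -> {for l, continuous (x^~ p)},
        forall p, p \in S -> gamma sigma f (x l) l p = 0,
        forall p q, p \in B -> q \in B -> x l p = x l q &
        forall p, p \in S -> `|x l p - D p * scale (m p) l| <= M * scale (m p) l ^+ 2]].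

(** In the synchronous subspace all inputs move together, so [B] acts as one regular cell with slope
    [K] and [lambda] as only input. *)
Lemma root_branch : exists d M x, partial_branch B d M x.
Proof.
have [[[b bB] _] _ _ _] := rootB.
have eK : derive f 0 (\sum_i ex R i) = K by exact: derive_sum_dir1.
pose e : V R n := \sum_i ex R i; rewrite -/e in eK.
have H : cell_branch f e (fun l => l *: elam R n) 0 1 (ell / K).
  have cu (l : R) : - 1 < l < 0 -> {for l, continuous (fun l : R => l *: elam R n)}.
    by move=> _; exact: continuous_scale_id.
  have eK0 : derive f 0 e != 0 by rewrite eK; exact: K_neq0.
  (* [scale 0 l] is [- l], so [ell / K] cancels the linear part exactly and the error constant is
     [0]. *)
  apply: (branch_regular sf f0 ltr01 cu eK0 (normr_ge0 (elam R n)) (lexx 0)).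
  move=> l /andP[_ l0]; rewrite (scale0 l0) eK (deriveZ_dir _ _ _ sf) (divfK K_neq0); split.
    by rewrite [leLHS]normrZ ltr0_norm// mulrC.
  by rewrite -/(coef_ell f) mulrN mulrC subrr normr0 mul0r.
have [d [M [X [d0 d1 HX]]]] := H.
exists d, (Num.max M 0), (fun l _ => X l); split => //; first by rewrite le_max lexx orbT.
move=> l dl; have [cX bX zX] := HX l dl; split => //.
  move=> p pB; rewrite /gamma row_coord -zX addrC; congr (f (_ + _)).
  by rewrite scaler_sumr.
move=> p pB; rewrite D_root// mu_in//; apply: (le_trans bX).
by rewrite ler_wpM2r ?sqr_ge0// le_max lexx.
Qed.

Section Step.
Variables (S : {set C}) (d M : R) (x : R -> C -> R).
Hypothesis pbS : partial_branch S d M x.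

Let d0 : 0 < d. Proof. by case: pbS. Qed.
Let M0 : 0 <= M. Proof. by case: pbS. Qed.

Lemma dom_lt0 (l : R) : - d < l < 0 -> l < 0 /\ - 1 < l < 0.
Proof.
case: pbS => _ d1 _ _ /andP[h ->]; rewrite andbT; split => //.
by apply: le_lt_trans h; rewrite lerN2.
Qed.

Let Dmax : R := \sum_q `|D q|.

Lemma le_Dmax q : `|D q| <= Dmax.
Proof. by rewrite /Dmax (bigD1 q)//= lerDl sumr_ge0. Qed.

Lemma Dmax_ge0 : 0 <= Dmax. Proof. exact: sumr_ge0. Qed.

Lemma input_scale q k (l : R) : - d < l < 0 -> q \in S -> (m q <= k)%N ->
  `|x l q - (if m q == k then D q else 0) * scale k l| <= (M + Dmax) * scale k l ^+ 2.
Proof.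
move=> dl qS qk; case: pbS => _ _ _ /(_ l dl)[_ _ _ /(_ q qS) bq].
have [l0 l1] := dom_lt0 dl.
case: eqP qk => [<- _|/eqP nk].
  apply: (le_trans bq); rewrite ler_wpM2r ?sqr_ge0// lerDl; exact: Dmax_ge0.
rewrite leq_eqVlt (negbTE nk) /= => qk; rewrite mul0r subr0.
have h := le_scale_sqr l1 qk; have s0 := scale_gt0 (m q) l0; have s1 := scale_le1 (m q) l1.
have -> : x l q = (x l q - D q * scale (m q) l) + D q * scale (m q) l by rewrite subrK.
apply: (@le_trans _ _ (M * scale (m q) l + Dmax * scale (m q) l)).
  apply: normD_le.
    by apply: (le_trans bq); rewrite ler_wpM2l// expr2 ler_piMl// ltW.
  by rewrite normrM (gtr0_norm s0) ler_wpM2r ?(ltW s0)// le_Dmax.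
by rewrite -mulrDl ler_wpM2l// addr_ge0// Dmax_ge0.
Qed.

Lemma input_estimate p k :
  (forall i, sigma i p != p -> sigma i p \in S /\ (m (sigma i p) <= k)%N) ->
  exists kappa c1 : R, [/\ 0 <= kappa, 0 <= c1 & forall l : R, - d < l < 0 ->
    `|input_vec sigma (x l) l p| <= kappa * scale k l /\
    `|derive f 0 (input_vec sigma (x l) l p) - drive p k * scale k l| <= c1 * scale k l ^+ 2].
Proof.
move=> Hin.
have MD0 : 0 <= M + Dmax by rewrite addr_ge0// Dmax_ge0.
have DMD0 : 0 <= Dmax + (M + Dmax) by rewrite addr_ge0// Dmax_ge0.
exists (\sum_(i | sigma i p != p) (Dmax + (M + Dmax)) * `|ex R i| + `|elam R n|).
exists (\sum_(i | sigma i p != p) (M + Dmax) * `|a i| + `|ell|).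
split.
- by rewrite addr_ge0// sumr_ge0// => i _; rewrite mulr_ge0.
- by rewrite addr_ge0// sumr_ge0// => i _; rewrite mulr_ge0.
move=> l dl; have [l0 l1] := dom_lt0 dl.
have s0 := scale_gt0 k l0; have s1 := scale_le1 k l1.
have ss : scale k l ^+ 2 <= scale k l by rewrite expr2 ler_piMl// ltW.
(* [lambda] behaves like an input of depth [0]: it is [- scale 0 l] when [k = 0] and belongs to the
   error when [k > 0]. *)
have lk : `|l + (if k == 0%N then scale k l else 0)| <= scale k l ^+ 2.
  case: (posnP k) => [->|k0]; first by rewrite scale0// subrr normr0 sqr_ge0.
  rewrite addr0 ltr0_norm// -scale0//; exact: le_scale_sqr.
have lk' : `|l| <= scale k l.
  case: (posnP k) => [->|k0]; first by rewrite ltr0_norm// scale0.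
  by rewrite ltr0_norm// -scale0// (le_trans _ ss)// le_scale_sqr.
have Hx i : sigma i p != p -> `|x l (sigma i p) -
     (if m (sigma i p) == k then D (sigma i p) else 0) * scale k l| <= (M + Dmax) * scale k l ^+ 2.
  by move=> /Hin[iS ik]; exact: input_scale.
split.
  rewrite [leRHS]mulrDl mulr_suml; apply: (le_trans (ler_normD _ _)); apply: lerD.
    apply: (le_trans (ler_norm_sum _ _ _)); apply: ler_sum => i ip.
    rewrite [leLHS]normrZ mulrAC ler_wpM2r//.
    rewrite -[x l _](subrK ((if m (sigma i p) == k then D (sigma i p) else 0) * scale k l)).
    rewrite addrC [leRHS]mulrDl; apply: normD_le.
      rewrite normrM (gtr0_norm s0) ler_wpM2r ?(ltW s0)//.
      by case: ifP => _; rewrite ?normr0 ?le_Dmax// Dmax_ge0.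
    by apply: (le_trans (Hx i ip)); rewrite ler_wpM2l.
  by rewrite [leLHS]normrZ mulrC ler_wpM2l.
rewrite derive_input// /drive.
have -> : \sum_(i | sigma i p != p) x l (sigma i p) * a i + l * ell -
   (\sum_(i | sigma i p != p) a i * (if m (sigma i p) == k then D (sigma i p) else 0) -
      (if k == 0%N then ell else 0)) * scale k l =
   \sum_(i | sigma i p != p) (x l (sigma i p) - (if m (sigma i p) == k then D (sigma i p) else 0)
       * scale k l) * a i + (l + (if k == 0%N then scale k l else 0)) * ell.
  rewrite mulrBl opprD opprK addrACA [X in _ = _ + X]mulrDl; congr (_ + _).
    rewrite mulr_suml -sumrB; apply: eq_bigr => i _.
    by rewrite [RHS]mulrBl; congr (_ - _); rewrite -mulrA mulrC.
  by congr (_ + _); case: ifP => _; rewrite ?mul0r// mulrC.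
rewrite [leRHS]mulrDl mulr_suml; apply: normD_le.
  apply: (le_trans (ler_norm_sum _ _ _)); apply: ler_sum => i ip.
  by rewrite normrM mulrAC ler_wpM2r// Hx.
by rewrite normrM mulrC ler_wpM2l.
Qed.

Lemma regular_cell p : p \notin B -> ~~ crit p ->
  (forall i, sigma i p != p -> sigma i p \in S) ->
  cell_branch f (self_dir sigma R p) (fun l => input_vec sigma (x l) l p) (m p) d (D p).
Proof.
move=> pB ncp inS.
have mk : (m p - crit p)%N = m p by rewrite (negbTE ncp) subn0.
have [|kappa [c1 [k0 c10 Hest]]] := @input_estimate p (m p).
  by move=> i ip; split; [exact: inS|have := mu_input_le ff rootB pB ip; rewrite mk].
have SL0 : derive f 0 (self_dir sigma R p) != 0 by rewrite derive_self.
apply: (branch_regular sf f0 d0 _ SL0 k0 c10).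
  move=> l dl; apply: continuous_input => i ip.
  by case: pbS => _ _ _ /(_ l dl)[h _ _ _]; exact/h/inS.
move=> l dl; have [h1 h2] := Hest l dl; split => //.
rewrite derive_self//.
suff -> : D p * SL p = - drive p (m p) by rewrite mulNr.
have nSL : SL p != 0 by rewrite -derive_self.
have := driveE pB; rewrite mk => ->; case: ifP => [/eqP m0|/negbT]; last rewrite -lt0n => m0.
  by rewrite (D_regular0 pB ncp m0) divfK.
by rewrite (D_regular pB ncp m0) divfK.
Qed.

Lemma sqr_pmsqrt (y z : R) : z < 0 -> (y = Num.sqrt (- z) \/ y = - Num.sqrt (- z)) ->
  y ^+ 2 = - z.
Proof.
by move=> z0 [->|->]; rewrite ?sqrrN sqr_sqrtr// oppr_ge0 ltW.
Qed.

(** The inputs live at scale [k = m p - 1], the square of the scale of [p]. Either sign of the root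
    makes [A y^2] cancel their leading part. *)
Lemma fold_cell p : p \notin B -> crit p -> (0 < m p)%N ->
  (forall i, sigma i p != p -> sigma i p \in S) ->
  cell_branch f (self_dir sigma R p) (fun l => input_vec sigma (x l) l p) (m p) d (D p).
Proof.
move=> pB cp m0 inS.
have [k mk] : exists k, m p = k.+1 by exists (m p).-1; rewrite prednK.
have mck : (m p - crit p)%N = k by rewrite cp mk subn1.
have [|kappa [c1 [k0 c10 Hest]]] := @input_estimate p k.
  by move=> i ip; split; [exact: inS|have := mu_input_le ff rootB pB ip; rewrite mck].
have SL0 : derive f 0 (self_dir sigma R p) = 0 by rewrite derive_self//; exact/eqP.
have Q : A p != 0 /\ A p * D p ^+ 2 = - drive p k.
  have := driveE pB; rewrite mck => ->; case: ifP => [/eqP kk0|/negbT]; last rewrite -lt0n => kk0.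
    have [] := D_critical1 cp (_ : m p = 1%N); first by rewrite mk kk0.
    move=> h1 h2.
    have A0 : A p != 0 by apply: contraTneq h1 => ->; rewrite invr0 mulr0 ltxx.
    split => //; rewrite (sqr_pmsqrt h1); first by rewrite mulrN mulrCA divff// mulr1.
    by rewrite -mulNr.
  have [] := D_critical cp (_ : (1 < m p)%N); first by rewrite mk ltnS.
  move=> h1 h2.
  have A0 : A p != 0 by apply: contraTneq h1 => ->; rewrite invr0 mulr0 ltxx.
  split => //; rewrite (sqr_pmsqrt h1); first by rewrite mulrN mulrCA divff// mulr1.
  by rewrite -mulNr.
have [A0 AD] := Q; rewrite mk.
apply: (branch_fold sf f0 d0 _ SL0 (derive2_self sigma sf p) A0 (D_neq0 p) k0 c10).
  move=> l dl; apply: continuous_input => i ip.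
  by case: pbS => _ _ _ /(_ l dl)[h _ _ _]; exact/h/inS.
move=> l dl; have [h1 h2] := Hest l dl; have [l0 l1] := dom_lt0 dl.
rewrite AD (scaleS k l0); split => //.
(* The input error is [s^4] at the scale [s] of [p]; [s <= 1] weakens it to the required [s^3]. *)
rewrite mulNr; apply: (le_trans h2); rewrite ler_wpM2l// -(scaleS k l0).
have := scale_gt0 k.+1 l0; have := scale_le1 k.+1 l1; move: (scale _ _) => s s1 s0.
rewrite (_ : (s ^+ 2) ^+ 2 = s * s ^+ 3); last by ring.
by rewrite ler_piMl// exprn_ge0// ltW.
Qed.

Hypotheses (BS : forall p, p \in B -> p \in S)
  (Sclosed : forall i p, p \in S -> sigma i p \in S).

(** All other inputs lie in [B], so [X l] is already a zero; a second one is sought at distance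
    about [(D p - ell / K) s] from it. *)
Lemma first_critical_cell p : p \notin B -> crit p -> m p = 0%N ->
  cell_branch f (self_dir sigma R p) (fun l => input_vec sigma (x l) l p) (m p) d (D p).
Proof.
move=> pB cp mp.
have [[[b bB] _] _ _ _] := rootB.
pose X (l : R) := x l b; pose L := ell / K.
have inB i : sigma i p != p -> sigma i p \in B.
  by move=> ip; exact: (input_of_first_critical ff rootB pB cp mp ip).
have xX l : - d < l < 0 -> forall q, q \in B -> x l q = X l.
  by move=> dl q qB; case: pbS => _ _ _ /(_ l dl)[_ _ h _]; exact: h.
have cX l : - d < l < 0 -> {for l, continuous X}.
  by move=> dl; case: pbS => _ _ _ /(_ l dl)[h _ _ _]; exact/h/BS.
have splitX l : - d < l < 0 ->
    sync_vec n (X l) l = input_vec sigma (x l) l p + X l *: self_dir sigma R p.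
  by move=> dl; apply: sync_split => i ip; apply: xX => //; exact: inB.
have zX l : - d < l < 0 -> f (sync_vec n (X l) l) = 0.
  move=> dl; case: pbS => _ _ _ /(_ l dl)[_ h _ _].
  rewrite -(h b (BS bB)) sync_vecE /gamma; congr (f (_, _)).
  by apply/rowP => i; rewrite !mxE xX// (sub_closed rootB).
have bX l : - d < l < 0 -> `|X l - L * scale 0 l| <= M * scale 0 l ^+ 2.
  move=> dl; case: pbS => _ _ _ /(_ l dl)[_ _ _ h].
  by have := h b (BS bB); rewrite (D_root bB) (mu_in _ _ bB).
have [A0 ED] := D_critical0 pB cp mp.
(* If [D p] is the synchronous coefficient, [X] itself has the required expansion. *)
rewrite mp; have [EL|nL] := eqVneq (D p) L.
  exists d, M, X; split => // l dl; rewrite EL -splitX//; split; [exact: cX|exact: bX|exact: zX].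
have D'0 : D p - L != 0 by rewrite subr_eq0.
have SL0 : derive f 0 (self_dir sigma R p) = 0 by rewrite derive_self//; exact/eqP.
pose kappa := (`|L| + M) * `|\sum_i ex R i : V R n| + `|elam R n|.
pose c1 := M * `|2 * A p + 2 * Mix p|.
have k0 : 0 <= kappa by rewrite addr_ge0// mulr_ge0// addr_ge0.
have c10 : 0 <= c1 by rewrite mulr_ge0.
have cu l : - d < l < 0 -> {for l, continuous (fun l => sync_vec n (X l) l)}.
  by move=> dl; exact/continuous_sync/cX.
have [|d' [M' [y [d'0 d'd Hy]]]] := @branch_transcritical _ _ _ sf _ _ 0 _ d0 cu _ _ _ _
    SL0 (derive2_self sigma sf p) A0 D'0 k0 c10.
  move=> l dl; have [l0 l1] := dom_lt0 dl; split; first exact: zX.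
    have s0 := scale_gt0 0 l0; have s1 := scale_le1 0 l1.
    have XL : `|X l| <= (`|L| + M) * scale 0 l.
      rewrite -[X l](subrK (L * scale 0 l)) addrC [leRHS]mulrDl; apply: normD_le.
        by rewrite normrM (gtr0_norm s0).
      by apply: (le_trans (bX l dl)); rewrite ler_wpM2l// expr2 ler_piMl// ltW.
    rewrite [leRHS]mulrDl; apply: (le_trans (ler_normD _ _)); apply: lerD.
      by rewrite [leLHS]normrZ mulrAC ler_wpM2r.
    by rewrite [leLHS]normrZ mulrC ler_wpM2l// ltr0_norm// scale0.
  rewrite derive2_sync//.
  have -> : X l * (2 * A p + 2 * Mix p) + l * Fl p + A p * (D p - L) * scale 0 l =
     (X l - L * scale 0 l) * (2 * A p + 2 * Mix p).
    (* The formula for [D p] with denominators cleared. *)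
    have -> : A p * (D p - L) = - L * (2 * A p + 2 * Mix p) + Fl p.
      have aux (x1 x2 x3 x4 : R) : x1 != 0 ->
          x1 * (- x4 * (1 + 2 * (x2 / x1)) + x3 / x1 - x4) = - x4 * (2 * x1 + 2 * x2) + x3.
        by move=> ?; field.
      by rewrite ED; exact: aux.
    have aux (x1 x2 x3 x4 : R) : x1 * x2 + l * x3 + (- x4 * x2 + x3) * (- l) =
        (x1 - x4 * (- l)) * x2 by ring.
    by rewrite scale0.
  by rewrite /c1 normrM [leRHS]mulrAC; apply: ler_wpM2r => //; exact: bX.
exists d', (M + M'), (fun l => X l + y l); split => // l dl'.
have dl : - d < l < 0.
  by case/andP: dl' => h ->; rewrite andbT (le_lt_trans _ h)// lerN2.
have [cy bdy zy] := Hy l dl'; split.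
- by apply: cvgD; [exact: cX|exact: cy].
- have -> : X l + y l - D p * scale 0 l = (X l - L * scale 0 l) + (y l - (D p - L) * scale 0 l).
    have aux (x1 x2 x3 x4 x5 : R) :
      x1 + x2 - x3 * x5 = (x1 - x4 * x5) + (x2 - (x3 - x4) * x5) by ring.
    exact: aux.
  by rewrite [leRHS]mulrDl; apply: normD_le => //; exact: bX.
- by rewrite scalerDl addrA -splitX.
Qed.

Lemma cell_exists p : p \notin S -> (forall i, sigma i p != p -> sigma i p \in S) ->
  cell_branch f (self_dir sigma R p) (fun l => input_vec sigma (x l) l p) (m p) d (D p).
Proof.
move=> pS inS; have pB : p \notin B by apply: contraNN pS; exact: BS.
have [cp|cp] := boolP (crit p); last exact: regular_cell.
have [m0|m0] := posnP (m p); first exact: first_critical_cell.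
exact: fold_cell.
Qed.

(** The old equations survive because [S] is closed under inputs and does not contain [p]. *)
Lemma extend_branch p : p \notin S -> (forall i, sigma i p != p -> sigma i p \in S) ->
  exists d' M' x', partial_branch (p |: S)%SET d' M' x'.
Proof.
move=> pS inS; have [d' [M' [y [d'0 d'd Hy]]]] := cell_exists pS inS.
pose x' (l : R) q := if q == p then y l else x l q.
have xS l q : q \in S -> x' l q = x l q.
  by move=> qS; rewrite /x'; case: eqP => // E; move: pS; rewrite -E qS.
have xp l : x' l p = y l by rewrite /x' eqxx.
exists d', (Num.max M M'), x'; case: (pbS) => _ d1 _ H; split => //.
- exact: le_trans d1.
- by rewrite le_max M0.
move=> l dl'.
have dl : - d < l < 0.
  by case/andP: dl' => h ->; rewrite andbT (le_lt_trans _ h)// lerN2.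
have [cy bdy zy] := Hy l dl'; have [h1 h2 h3 h4] := H l dl; split.
- move=> q; rewrite in_setU1 => /orP[/eqP->|qS].
    by have -> : x'^~ p = y by apply/funext => t; exact: xp.
  have -> : x'^~ q = x^~ q by apply/funext => t; exact: xS.
  exact: h1.
- move=> q; rewrite in_setU1 => /orP[/eqP->|qS].
    rewrite gamma_split xp -[RHS]zy; congr (f (_ + _)).
    rewrite /input_vec; congr (_ + _); apply: eq_bigr => i ip; by rewrite xS// inS.
  rewrite -[RHS](h2 q qS) /gamma; congr (f (_, _)).
  by apply/rowP => i; rewrite !mxE xS// Sclosed.
- by move=> q r qB rB; rewrite !xS ?BS//; exact: h3.
- move=> q; rewrite in_setU1 => /orP[/eqP->|qS].
    by rewrite xp; apply: (le_trans bdy); rewrite ler_wpM2r ?sqr_ge0// le_max lexx orbT.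
  by rewrite xS//; apply: (le_trans (h4 q qS)); rewrite ler_wpM2r ?sqr_ge0// le_max lexx.
Qed.

End Step.

(** Induction on the number of unsolved cells, starting from [B]; a topmost unsolved cell has all
    its other inputs solved. *)
Lemma full_branch : exists d M x, partial_branch [set: C]%SET d M x.
Proof.
have [[[b bB] closedB] _ _ _] := rootB.
suff H N : forall S : {set C}, (#|C| - #|S| <= N)%N -> (forall p, p \in B -> p \in S) ->
    (forall i p, p \in S -> sigma i p \in S) ->
    (exists d M x, partial_branch S d M x) -> exists d M x, partial_branch [set: C]%SET d M x.
  by apply: (H _ B (leqnn _)) => //; exact: root_branch.
elim: N => [|N IH] S cS BS closedS pb.
  suff -> : [set: C]%SET = S by [].
  apply/eqP; rewrite eq_sym eqEcard; apply/andP; split.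
    by apply/fintype.subsetP => q _; rewrite finset.in_setT.
  by rewrite cardsT -subn_eq0 -leqn0.
have [allS|/forallPn[q qS]] := boolP [forall q, q \in S].
  suff -> : [set: C]%SET = S by [].
  by apply/setP => q; rewrite finset.in_setT; have /forallP/(_ q)-> := allS.
have [p pS inS] := next_cell ff (ex_intro _ q qS).
have [d [M [x pbS]]] := pb.
apply: (IH (p |: S)%SET).
- by rewrite cardsU1 pS add1n subnS -subn1 leq_subLR add1n.
- by move=> r rB; rewrite in_setU1 BS// orbT.
- move=> i r; rewrite !in_setU1 => /orP[/eqP->|rS]; last by rewrite closedS// orbT.
  by have [//|ip] := eqVneq (sigma i p) p; rewrite inS// orbT.
- exact: extend_branch pbS BS closedS p pS inS.
Qed.

End BranchInduction.

Theorem theorem4p22 (C : finType) (n : nat) (sigma : 'I_n.+1 -> C -> C)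
  (R : realType) (f : V R n -> R) (B : {set C}) (D : C -> R) :
  (* network: sigma_1 = Id, pairwise distinct maps, feedforward *)
  sigma ord0 =1 id ->
  (forall i j, sigma i =1 sigma j -> i = j) ->
  feedforward sigma ->
  (* smooth f *)
  smooth f ->
  (* assumption (B) *)
  f 0 = 0 ->
  (exists p, critical sigma (coef_a f) p) ->
  (forall q, critical sigma (coef_a f) q <->
     exists p, critical sigma (coef_a f) p /\ Lset sigma p = Lset sigma q) ->
  (* critical cells are non-maximal *)
  (forall p, critical sigma (coef_a f) p -> ~~ maximal sigma p) ->
  (* B is a root subnetwork *)
  root_subnetwork sigma (coef_a f) B ->
  let a := coef_a f in
  let K := \sum_i a i in
  let ell := coef_ell f in
  let crit := critical sigma a in
  let m := mu sigma a B in
  let SL p := \sum_(i | sigma i p == p) a i in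
  let Sext p := \sum_(i | sigma i p != p) a i * D (sigma i p) in
  let SQ p := \sum_(i | inQ sigma a B p (sigma i p)) a i * D (sigma i p) in
  let A p := \sum_(i | sigma i p == p) \sum_(j | sigma j p == p) coef_f2 f i j in
  let Mix p := \sum_(i | sigma i p == p) \sum_(j | sigma j p != p) coef_f2 f i j in
  let Fl p := \sum_(i | sigma i p == p) coef_flam f i in
  (* the recursively defined real non-zero coefficients D_p *)
  (forall p, D p != 0) ->
  (forall p, p \in B -> D p = ell / K) ->
  (forall p, p \notin B -> ~~ crit p -> m p = 0%N ->
     D p = - (Sext p - ell) / SL p) ->
  (forall p, p \notin B -> ~~ crit p -> (0 < m p)%N ->
     D p = - SQ p / SL p) ->
  (forall p, p \notin B -> crit p -> m p = 0%N ->
     A p != 0 /\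
     D p = - (ell / K) * (1 + 2 * (Mix p / A p)) + Fl p / A p) ->
  (forall p, crit p -> m p = 1%N ->
     (Sext p - ell) / A p < 0 /\
     (D p = Num.sqrt (- (Sext p - ell) / A p) \/
      D p = - Num.sqrt (- (Sext p - ell) / A p))) ->
  (forall p, crit p -> (1 < m p)%N ->
     SQ p / A p < 0 /\
     (D p = Num.sqrt (- SQ p / A p) \/ D p = - Num.sqrt (- SQ p / A p))) ->
  (* conclusion: a branch of steady states for small lambda < 0 *)
  exists (delta M : R) (x : R -> C -> R) (X : R -> R),
    0 < delta /\
    (forall p, {within `]- delta, 0[, continuous (fun l => x l p)}) /\
    forall l, - delta < l < 0 ->
      (forall p, gamma sigma f (x l) l p = 0) /\
      (forall p, p \in B ->
         x l p = X l /\ `|X l - D p * (- l)| <= M * l ^+ 2) /\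
      (forall p, p \notin B ->
         `|x l p - D p * ((- l) `^ (2 ^+ m p)^-1)|
            <= M * (`|l| `^ (2 / 2 ^+ m p))).
Proof.
move=> _ _ ff sf f0 _ _ critNmax rootB a K ell crit m SL Sext SQ A Mix Fl.
move=> D_neq0 D_root D_reg0 D_reg D_crit0 D_crit1 D_crit.
have [d [M [x [d0 d1 M0 H]]]] := full_branch ff sf f0 critNmax rootB D_neq0 D_root
  D_reg0 D_reg D_crit0 D_crit1 D_crit.
have [[[b bB] _] _ _ _] := rootB.
(* The cells of [B] agree, so any one of them serves as [X]. *)
exists d, M, x, (fun l => x l b); split => //; split.
  move=> p; apply: continuous_in_subspaceT => l; rewrite inE/= in_itv/= => dl.
  by have [h _ _ _] := H l dl; apply: h; rewrite finset.in_setT.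
move=> l dl; have [_ h2 h3 h4] := H l dl; have /andP[_ l0] := dl.
split; first by move=> p; apply: h2; rewrite finset.in_setT.
split => p pB.
  rewrite (h3 b p bB pB); split => //.
  have := h4 p; rewrite finset.in_setT => /(_ isT).
  by rewrite (mu_in _ _ pB) (scale0 l0) sqrrN.
have := h4 p; rewrite finset.in_setT => /(_ isT).
by rewrite (scale_sqr _ l0).
Qed.
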